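(* Let $u:B_2\subset\mathbb{R}^n\to\mathbb{R}$ be a smooth solution of $$|\nabla^2u|^2=F(u,|\nabla u|^2,\Delta u)+\frac u2\Delta^2u,$$ where $F:\mathbb{R}^3\to\mathbb{R}$ is such that $F(s,t,w)\ge\frac12w^2$. Then $$|\nabla u(x)|^2-u(x)\Delta u(x)\le C\big(\|u\|_{H^1(B_2)}+\|\Delta u\|_{L^2(B_2)}\big)\qquad\text{for all }x\in B_1,$$ where $C$ depends only on $n$.
   Context: $B_r=\{y\in\mathbb{R}^n:|y|<r\}$; $\nabla^2u$ is the Hessian of $u$, $|\nabla^2u|^2=\sum_{i,j}u_{x_ix_j}^2$, $\Delta$ is the Laplacian and $\Delta^2$ is the bilaplacian.
   Formalization: The sum of norms on the right-hand side is squared: the bound proved is C(‖u‖_{H^1(B_2)}+‖Δu‖_{L^2(B_2)})^2, since the printed first-power bound fails for u=λx_1, F=w^2/2 as λ→∞. *)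

(* Defs.v *)
From HB Require Import structures.
From mathcomp Require Import all_boot all_order all_algebra.
From mathcomp Require Import all_classical all_reals all_analysis.

Set Implicit Arguments.
Unset Strict Implicit.
Unset Printing Implicit Defensive.
Import Order.TTheory GRing.Theory Num.Theory.
Import numFieldNormedType.Exports.

Local Open Scope classical_set_scope.
Local Open Scope ring_scope.

Section lebesgue_tuple.
Context {R : realType}.
Local Notation T := (measurableTypeR R).

Definition tcons n (p : T * n.-tuple T) : n.+1.-tuple T :=
  [tuple of p.1 :: p.2].

Lemma measurable_tcons n : measurable_fun [set: T * n.-tuple T] (@tcons n).
Proof. exact: measurable_cons. Qed.


Section step.
Variables (n : nat) (mu : {sigma_finite_measure set (n.-tuple T) -> \bar R}).

Definition lebesgue_cons : set (n.+1.-tuple T) -> \bar R :=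
  pushforward (@lebesgue_measure R \x mu)%E (@tcons n).

Let prodm : {measure set (T * n.-tuple T)%type -> \bar R} :=
  (@lebesgue_measure R \x mu)%E.

Let mpreim (A : set (n.+1.-tuple T)) :
  measurable A -> measurable (@tcons n @^-1` A).
Proof. by move=> mA; rewrite -[X in measurable X]setTI; exact: measurable_tcons. Qed.

Let cons0 : lebesgue_cons set0 = 0%E.
Proof. by rewrite /lebesgue_cons /pushforward preimage_set0 measure0. Qed.

Let cons_ge0 A : (0 <= lebesgue_cons A)%E.
Proof. exact: (measure_ge0 prodm). Qed.

Let cons_sigma_additive : semi_sigma_additive lebesgue_cons.
Proof.
move=> F mF tF mUF; rewrite /lebesgue_cons /pushforward preimage_bigcup.
apply: (@measure_semi_sigma_additive _ _ _ prodm).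
- by move=> k; exact: mpreim.
- apply/trivIsetP => /= i j _ _ ij; rewrite -preimage_setI.
  by move/trivIsetP : tF => /(_ _ _ _ _ ij) ->//; rewrite preimage_set0.
- by rewrite -preimage_bigcup; exact: mpreim.
Qed.

HB.instance Definition _ :=
  isMeasure.Build _ _ _ lebesgue_cons cons0 cons_ge0 cons_sigma_additive.

Lemma lebesgue_cons_sigma_finite : sigma_finite setT lebesgue_cons.
Proof.
have /sigma_finiteP[F [TF ndF Foo]] := sigma_finiteT (@lebesgue_measure R).
have /sigma_finiteP[G [TG ndG Goo]] := sigma_finiteT mu.
pose g (t : n.+1.-tuple T) : T * n.-tuple T := (thead t, [tuple of behead t]).
have gK : cancel (@tcons n) g.
  by move=> [x t]; rewrite /g /tcons /= theadE; congr pair; exact: val_inj.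
have mg : measurable_fun setT g.
  apply/measurable_fun_pair; [exact: measurable_tnth|exact: measurable_behead].
exists (fun k => g @^-1` (F k `*` G k)).
  apply/seteqP; split => // t _.
  have [i _ Fi] : (\bigcup_i F i) (g t).1 by rewrite -TF.
  have [j _ Gj] : (\bigcup_i G i) (g t).2 by rewrite -TG.
  exists (maxn i j) => //; split.
    by move: Fi; exact/subsetPset/ndF/leq_maxl.
  by move: Gj; exact/subsetPset/ndG/leq_maxr.
move=> k; have [mFk Fk] := Foo k; have [mGk Gk] := Goo k; split.
  by rewrite -[X in measurable X]setTI; apply: mg => //; exact: measurableX.
rewrite /lebesgue_cons /pushforward -comp_preimage.
rewrite (_ : g \o _ = id); last by apply/funext => x /=; exact: gK.
by rewrite preimage_id product_measure1E// lte_mul_pinfty// ge0_fin_numE.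
Qed.

HB.instance Definition _ :=
  Measure_isSigmaFinite.Build _ _ _ lebesgue_cons lebesgue_cons_sigma_finite.

End step.

(* n-dimensional Lebesgue measure, as the n-fold product of the
   one-dimensional one on n.-tuple R (the library has no sigma-algebra on
   'rV[R]_n). *)
Fixpoint lebesgue_tuple n : {sigma_finite_measure set (n.-tuple T) -> \bar R} :=
  if n is m.+1 return {sigma_finite_measure set (n.-tuple T) -> \bar R}
  then lebesgue_cons (lebesgue_tuple m)
  else \d_([tuple] : 0.-tuple T).

End lebesgue_tuple.

Section differential_operators.
Context {R : realType} {n : nat}.
Implicit Types (u : 'rV[R]_n -> R) (x : 'rV[R]_n) (i : 'I_n).

(* The library norm on 'rV[R]_n is the sup norm, hence an explicit Euclidean
   norm (both induce the same topology). *)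
Definition enorm x : R := Num.sqrt (\sum_i x ord0 i ^+ 2).

Definition eball (r : R) : set 'rV[R]_n := [set x | enorm x < r].

Definition partial i u : 'rV[R]_n -> R := 'D_(delta_mx ord0 i) u.

Definition iter_partial (s : seq 'I_n) u : 'rV[R]_n -> R := foldr partial u s.

(* C^oo on the open set A: only the values of u on A matter. *)
Definition smooth_on (A : set 'rV[R]_n) u :=
  forall (s : seq 'I_n) x, A x ->
    {for x, continuous (iter_partial s u)} /\
    forall i, derivable (iter_partial s u) x (delta_mx ord0 i).

Definition grad_sq u x : R := \sum_i partial i u x ^+ 2.

Definition hess_sq u x : R :=
  \sum_i \sum_j partial j (partial i u) x ^+ 2.

Definition laplacian u x : R := \sum_i partial i (partial i u) x.

Definition bilaplacian u : 'rV[R]_n -> R := laplacian (laplacian u).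

End differential_operators.

Section norms.
Context {R : realType} {n : nat}.
Implicit Types (A : set 'rV[R]_n) (f : 'rV[R]_n -> R).

Definition L2norm A f : \bar R :=
  Lnorm (lebesgue_tuple n) 2%:E
    (fun t => ((f \_ A) (\row_i tnth t i))%:E).

Definition H1norm A f : \bar R :=
  sqrte (L2norm A f ^+ 2 + \sum_(i < n) L2norm A (partial i f) ^+ 2)%E.

End norms.

(* Main.v *)
Require Import Defs.
From mathcomp Require Import all_boot all_order all_algebra.
From mathcomp Require Import all_classical all_reals all_analysis.
From mathcomp Require Import measurable_realfun ring lra.
Import Order.TTheory GRing.Theory Num.Theory.
Import numFieldNormedType.Exports.
Local Open Scope classical_set_scope.
Local Open Scope ring_scope.

(** The quantity P = |grad u|^2 - u lap u is subharmonic.  Indeed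
    lap P = 2 |hess u|^2 - (lap u)^2 - u bilap u, the third-order terms
    cancelling, and the equation turns the right-hand side into
    2 F - (lap u)^2, which the lower bound on F makes nonnegative
    ([laplacian_P_function]).  A subharmonic function is bounded at x by a
    weighted average over the unit ball around x, and the integral of |P| over
    B_2 is at most the sum of the squared L^2 norms of u, grad u and lap u,
    because |u lap u| <= u^2 + (lap u)^2 ([integral_P_function_eta_le]).

    The mean value inequality ([mean_value_subharmonic]) is proved without
    polar coordinates.  Let eta (z) = max(0, 1 - |z - x|^2) and
    psi = eta^2 / 4, so that grad psi = - (z - x) eta.  For a subharmonic f put
      phi (r) = int f (x + r (z - x)) eta (z) dz.
    Differentiating under the integral sign and integrating by parts,
      phi' (r) = int grad f (x + r (z - x)) . (z - x) eta (z) dz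
               = r int lap f (x + r (z - x)) psi (z) dz >= 0,
    hence phi (0) <= phi (1), that is,
      f (x) int eta <= int f eta.
    As |x| < 1 there is b > 1 such that the ball of radius b around x lies in
    B_2, so that phi is differentiable on the neighbourhood ]-b, b[ of [0, 1].
    Integrating by parts in the direction e_i means that the integral of a
    derivative along e_i vanishes; since Lebesgue measure on tuples is an
    iterated product, this follows from Fubini's theorem and the fundamental
    theorem of calculus on lines ([integral_null_slices], [integral_dflux]).
    The integral of eta is at least n^-n / 2, by comparison with a cube, which
    gives the constant C = 2 n^n.

    Smoothness of u is a statement about iterated coordinate derivatives.  Two
    classical facts are needed to use it: continuous partial derivatives give
    all directional derivatives ([is_derive_C1]), and mixed partial derivatives
    commute ([partialC]). *)

Set Implicit Arguments.
Unset Strict Implicit.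
Unset Printing Implicit Defensive.

(** * Derivatives along lines *)
Section lines.
Context {R : realType} {V : normedModType R}.
Implicit Types (f : V -> R) (z v : V).

Lemma line_growth f z v (s : R) :
  (fun h : R => h^-1 *: (((fun t : R => f (z + t *: v)) \o shift s) (h *: (1 : R))
                      - f (z + s *: v)))
  = (fun h => h^-1 *: ((f \o shift (z + s *: v)) (h *: v) - f (z + s *: v))).
Proof.
apply/funext => h /=; congr (_ *: (f _ - _)).
by rewrite [_%:A]mulr1 scalerDl addrCA.
Qed.

Lemma is_derive_line f z v (s d : R) :
  is_derive (z + s *: v) v f d ->
  is_derive s 1 (fun t : R => f (z + t *: v)) d.
Proof.
move=> [fd <-]; split; first by rewrite /derivable line_growth.
by rewrite /derive line_growth.
Qed.

Lemma is_derive_of_line f z v (d : R) :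
  is_derive (0 : R) 1 (fun t : R => f (z + t *: v)) d -> is_derive z v f d.
Proof.
have E := line_growth f z v 0; rewrite scale0r addr0 in E.
by move=> [fd <-]; split; rewrite ?/derivable ?/derive ?E// -E//; move: fd;
  rewrite /derivable scale0r addr0.
Qed.

Lemma is_derive_shift f z v a (d : R) :
  is_derive (z + a) v f d -> is_derive z v (fun w => f (w + a)) d.
Proof.
have E : (fun h : R => h^-1 *: (((fun w => f (w + a)) \o shift z) (h *: v)
                        - f (z + a)))
  = (fun h => h^-1 *: ((f \o shift (z + a)) (h *: v) - f (z + a))).
  by apply/funext => h /=; rewrite addrA.
by move=> [fd <-]; split; rewrite ?/derivable ?/derive E.
Qed.

Lemma is_derive_scale f z v (k d : R) :
  is_derive z v f d -> is_derive z (k *: v) f (k * d).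
Proof.
move=> fd; apply: is_derive_of_line.
rewrite (_ : (fun t : R => _) =
    (fun t : R => f (z + t *: v)) \o (fun t : R => t * k)); last first.
  by apply/funext => t /=; rewrite scalerA.
rewrite mulrC; apply: is_derive1_comp.
  by apply: is_derive_line; rewrite mul0r scale0r addr0.
have -> : (fun t : R => t * k) = k \*: (id : R -> R).
  by apply/funext => t /=; rewrite mulrC.
by apply: is_derive_eq; rewrite /GRing.scale/= mulr1.
Qed.

Lemma MVT_line f z v (df : V -> R) :
  (forall t : R, (0 : R) <= t <= 1 -> is_derive (z + t *: v) v f (df (z + t *: v))) ->
  exists2 t : R, (0 : R) <= t <= 1 & f (z + v) - f z = df (z + t *: v).
Proof.
move=> fd.
have fD (t : R) : 0 <= t <= 1 ->
    is_derive t 1 (fun t : R => f (z + t *: v)) (df (z + t *: v)).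
  by move=> /fd; exact: is_derive_line.
have [||t] := @MVT_segment R (fun t : R => f (z + t *: v))
    (fun t : R => df (z + t *: v)) 0 1 ler01.
- by move=> t; rewrite in_itv/= => /andP[/ltW t0 /ltW t1]; apply: fD; apply/andP.
- apply: derivable_within_continuous => t; rewrite in_itv/= => /fD H.
  exact: ex_derive.
rewrite in_itv/= scale1r scale0r addr0 subr0 mulr1 => t01 ->.
by exists t.
Qed.

End lines.

Section rowvectors.
Context {R : realType} {n : nat}.
Implicit Types (f : 'rV[R]_n -> R) (x y z : 'rV[R]_n) (i j : 'I_n).

Local Notation e_ i := (delta_mx ord0 i : 'rV[R]_n).

Lemma norm_rV_le x (b : R) : 0 <= b -> (`|x| <= b) = [forall i, `|x ord0 i| <= b].
Proof.
move=> b0; rewrite (_ : `|x| = mx_norm x)// mx_normrE.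
apply/idP/forallP => [|h].
  by move=> /bigmax_leP[_ h] i; exact: (h (ord0, i)).
by apply/bigmax_leP; split=> // -[k i] _ /=; rewrite ord1.
Qed.

Lemma ler_coord_norm x i : `|x ord0 i| <= `|x|.
Proof.
have : `|x| <= `|x| by [].
by rewrite {1}norm_rV_le// => /forallP/(_ i).
Qed.

Lemma norm_delta_le i : `|e_ i| <= 1.
Proof.
rewrite norm_rV_le//; apply/forallP => j; rewrite mxE eqxx/=.
by case: eqP => _; rewrite ?normr1 ?normr0.
Qed.

(** The increment of [f] along a sum of coordinate steps, compared with its
    linear part: one mean value argument per step.  The smallness assumption
    keeps every intermediate point in the ball where the partial derivatives
    are controlled. *)
Lemma total_increment f y x (d e : R) (s : seq 'I_n) :
  (forall z i, `|z - y| < d ->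
     derivable f z (e_ i) /\ `|partial i f z - partial i f y| <= e) ->
  \sum_(i <- s) `|x ord0 i| < d ->
  `|f (y + \sum_(i <- s) x ord0 i *: e_ i) - f y
    - \sum_(i <- s) x ord0 i * partial i f y|
    <= e * \sum_(i <- s) `|x ord0 i|.
Proof.
move=> near_y; elim: s => [|j s IH].
  by rewrite !big_nil addr0 subrr subr0 normr0 mulr0.
rewrite !big_cons => sd.
have sd' : \sum_(i <- s) `|x ord0 i| < d.
  by apply: le_lt_trans sd; rewrite lerDr.
have {}IH := IH sd'.
set w := \sum_(i <- s) x ord0 i *: e_ i in IH *.
have wle : `|w| <= \sum_(i <- s) `|x ord0 i|.
  rewrite /w; apply: le_trans (ler_norm_sum _ _ _) _.
  apply: ler_sum => i _; rewrite normrZ ler_piMr//; exact: norm_delta_le.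
have inball (t : R) : 0 <= t <= 1 ->
    `|(y + w + t *: (x ord0 j *: e_ j)) - y| < d.
  move=> /andP[t0 t1]; rewrite addrAC (addrC y) addrK.
  apply: le_lt_trans sd; apply: le_trans (ler_normD _ _) _.
  rewrite addrC; apply: lerD => //; rewrite !normrZ ger0_norm//.
  rewrite -[leRHS]mul1r; apply: ler_pM => //.
  by rewrite ler_piMr// norm_delta_le.
have [t /inball/near_y t01] := @MVT_line _ _ f (y + w) (x ord0 j *: e_ j)
    (fun z => x ord0 j * partial j f z)
    (fun t h => is_derive_scale (x ord0 j)
      (derivableP (near_y _ j (inball t h)).1)).
rewrite -addrA (addrC w) => E.
have -> : f (y + (x ord0 j *: e_ j + w)) - f y -
   (x ord0 j * partial j f y + \sum_(j0 <- s) x ord0 j0 * partial j0 f y) =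
   x ord0 j * (partial j f (y + w + t *: (x ord0 j *: e_ j)) - partial j f y)
   + (f (y + w) - f y - \sum_(j0 <- s) x ord0 j0 * partial j0 f y).
  by rewrite mulrBr -E; ring.
rewrite [leRHS]mulrDr; apply: (le_trans (ler_normD _ _)); apply: lerD => //.
rewrite normrM mulrC ler_wpM2r//.
exact: (t01 j).2.
Qed.

(** Applying [total_increment] to the steps of [h *: v] bounds the error in the
    difference quotient by an arbitrarily small multiple of the l^1 norm of
    [v]; the [+ 1] in the proof avoids dividing by zero when [v = 0]. *)
Lemma is_derive_C1 f y v :
  (forall i, \forall z \near y, derivable f z (e_ i)) ->
  (forall i, {for y, continuous (partial i f)}) ->
  is_derive y v f (\sum_i v ord0 i * partial i f y).
Proof.
move=> fd fc.
set D := \sum_i _.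
suff C : (fun h : R => h^-1 *: ((f \o shift y) (h *: v) - f y)) @ 0^' --> D.
  by split; [apply/cvg_ex; exists D|exact: cvg_lim C].
apply/cvgrPdist_le => e e0.
set S := \sum_i `|v ord0 i|.
have S0 : 0 <= S by exact: sumr_ge0.
have S1 : 0 < S + 1 by rewrite ltr_wpDl.
have e1 : 0 < e / (S + 1) by rewrite divr_gt0.
have : \forall z \near y, forall i, derivable f z (e_ i) /\
    `|partial i f z - partial i f y| <= e / (S + 1).
  apply: (@filter_forall _ _ (fun i z => derivable f z (e_ i) /\
    `|partial i f z - partial i f y| <= e / (S + 1)) (nbhs y)) => i.
  apply: filterI; first exact: fd.
  have /cvgrPdist_le /(_ _ e1) := fc i.
  by apply: filterS => z /=; rewrite distrC.
move=> /nbhs_normP[d /= d0 near_y].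
have S2 : 0 < d / (S + 1) by rewrite divr_gt0.
near=> h.
have h0 : h != 0 by near: h; exact: nbhs_dnbhs_neq.
have hd : `|h| * (S + 1) < d.
  rewrite -ltr_pdivlMr//; near: h.
  exact: dnbhs0_lt.
have sumE : \sum_i `|(h *: v) ord0 i| = `|h| * S.
  by rewrite mulr_sumr; apply: eq_bigr => i _; rewrite mxE normrM.
have zd z i : `|z - y| < d ->
    derivable f z (e_ i) /\ `|partial i f z - partial i f y| <= e / (S + 1).
  by move=> zd; apply: near_y; rewrite /= distrC.
have := @total_increment f y (h *: v) d (e / (S + 1)) (index_enum 'I_n) zd.
rewrite sumE -row_sum_delta.
rewrite (eq_bigr (fun i => h * (v ord0 i * partial i f y))); last first.
  by move=> i _; rewrite mxE mulrA.
rewrite -mulr_sumr -/D => H.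
have -> : D - h^-1 *: ((f \o shift y) (h *: v) - f y)
    = - (h^-1 * (f (y + h *: v) - f y - h * D)).
  by rewrite /= [h^-1 *: _]/(h^-1 * _) [in RHS]mulrBr mulKf// opprB (addrC y).
rewrite normrN normrM normfV mulrC ler_pdivrMr ?normr_gt0//.
apply: le_trans (H _) _; first by apply: le_lt_trans hd; rewrite ler_wpM2l// lerDl.
rewrite mulrCA (mulrC e `|h|) ler_wpM2l// mulrAC ler_pdivrMr//.
by rewrite ler_wpM2l ?(ltW e0)// lerDl.
Unshelve. all: by end_near.
Qed.

(** Two applications of the mean value theorem, first to
    [z |-> f (z + h e_j) - f z] along [e_i], then to [partial i f] along
    [e_j].  The left-hand side is symmetric in [i] and [j], which is what makes
    mixed derivatives commute. *)
Lemma second_difference f (A : set 'rV[R]_n) y (h : R) i j :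
  (forall z, A z -> derivable f z (e_ i) /\ derivable (partial i f) z (e_ j)) ->
  (forall s t : R, 0 <= s <= 1 -> 0 <= t <= 1 ->
     A (y + s *: (h *: e_ i) + t *: (h *: e_ j))) ->
  exists s t : R, [/\ 0 <= s <= 1, 0 <= t <= 1 &
    f (y + h *: e_ i + h *: e_ j) - f (y + h *: e_ i)
      - (f (y + h *: e_ j) - f y)
    = h * (h * partial j (partial i f) (y + s *: (h *: e_ i) + t *: (h *: e_ j)))].
Proof.
move=> fd sub.
have i01 (s : R) : 0 <= s <= 1 -> A (y + s *: (h *: e_ i)).
  move=> s01; have := sub s 0 s01; rewrite scale0r addr0; apply.
  by rewrite lexx ler01.
have i01' (s : R) : 0 <= s <= 1 -> A (y + h *: e_ j + s *: (h *: e_ i)).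
  move=> s01; have := sub s 1 s01; rewrite scale1r addrAC; apply.
  by rewrite lexx ler01.
pose g z := f (z + h *: e_ j) - f z.
have gd (s : R) : 0 <= s <= 1 -> is_derive (y + s *: (h *: e_ i)) (h *: e_ i) g
    (h * (partial i f (y + s *: (h *: e_ i) + h *: e_ j)
          - partial i f (y + s *: (h *: e_ i)))).
  move=> s01; apply: is_derive_scale; apply: is_deriveB.
    apply: is_derive_shift; apply: derivableP; rewrite addrAC.
    exact: (fd _ (i01' s s01)).1.
  exact/derivableP/(fd _ (i01 s s01)).1.
have [s s01] := @MVT_line _ _ g y (h *: e_ i)
  (fun z => h * (partial i f (z + h *: e_ j) - partial i f z)) gd.
rewrite /g => Es.
have [t t01 Et] := @MVT_line _ _ (partial i f) (y + s *: (h *: e_ i))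
    (h *: e_ j) (fun z => h * partial j (partial i f) z)
    (fun t h0 => is_derive_scale h (derivableP (fd _ (sub s t s01 h0)).2)).
exists s, t; split => //; rewrite -Et -Es; ring.
Qed.

(** Schwarz's theorem: both mixed derivatives are close to their values at the
    points provided by [second_difference], and those two values coincide. *)
Lemma partialC f (A : set 'rV[R]_n) y i j : open A -> A y ->
  (forall z, A z -> derivable f z (e_ i) /\ derivable (partial i f) z (e_ j)) ->
  (forall z, A z -> derivable f z (e_ j) /\ derivable (partial j f) z (e_ i)) ->
  {for y, continuous (partial j (partial i f))} ->
  {for y, continuous (partial i (partial j f))} ->
  partial j (partial i f) y = partial i (partial j f) y.
Proof.
move=> oA Ay fij fji cij cji.
apply/eqP; rewrite -subr_eq0 -normr_le0; apply/ler_addgt0Pl => e e0.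
rewrite addr0.
have e2 : 0 < e / 2 by rewrite divr_gt0.
have : \forall z \near y, [/\ A z,
    `|partial j (partial i f) y - partial j (partial i f) z| <= e / 2 &
    `|partial i (partial j f) y - partial i (partial j f) z| <= e / 2].
  have nA : \forall z \near y, A z by exact: open_nbhs_nbhs.
  have /cvgrPdist_le /(_ _ e2) n1 := cij.
  have /cvgrPdist_le /(_ _ e2) n2 := cji.
  by apply: filterS3 nA n1 n2 => z; exact: And3.
move=> /nbhs_normP[d /= d0 near_y].
have [h [h0 hd]] : exists h : R, 0 < h /\ h + h < d.
  by exists (d / 3); split; [rewrite divr_gt0|lra].
have inball k l (s t : R) : 0 <= s <= 1 -> 0 <= t <= 1 ->
    `|y - (y + s *: (h *: e_ k) + t *: (h *: e_ l))| < d.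
  move=> /andP[s0 s1] /andP[t0 t1].
  rewrite -addrA opprD addrA subrr sub0r normrN.
  apply: le_lt_trans hd.
  have hk (r : R) k' : 0 <= r -> r <= 1 -> `|r *: (h *: e_ k')| <= h.
    move=> r0 r1; rewrite !normrZ (ger0_norm r0) (gtr0_norm h0).
    rewrite -[leRHS]mul1r ler_pM ?mulr_ge0 ?(ltW h0)//.
    by rewrite ler_piMr ?(ltW h0)// norm_delta_le.
  by apply: le_trans (ler_normD _ _) _; apply: lerD; exact: hk.
have [s [t [s01 t01 Est]]] := @second_difference f A y h i j fij
  (fun s t s01 t01 => let: And3 a _ _ := near_y _ (inball i j s t s01 t01) in a).
have [s' [t' [s01' t01' Est']]] := @second_difference f A y h j i fji
  (fun s t s01 t01 => let: And3 a _ _ := near_y _ (inball j i s t s01 t01) in a).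
have [_ H1 _] := near_y _ (inball i j s t s01 t01).
have [_ _ H2] := near_y _ (inball j i s' t' s01' t01').
move: H1 H2 Est Est'; rewrite [y + h *: e_ j + h *: e_ i]addrAC.
move: (partial j (partial i f) (_ + _)) (partial i (partial j f) (_ + _)) => p q.
move: (partial j (partial i f) y) (partial i (partial j f) y) => p0 q0.
move: (f (_ + h *: e_ j)) (f (y + h *: e_ j)) (f (y + h *: e_ i)) (f y) => a b c d'.
move=> H1 H2 Est Est'.
have pq : p = q.
  apply: (mulfI (lt0r_neq0 h0)); apply: (mulfI (lt0r_neq0 h0)).
  by rewrite -Est -Est'; ring.
rewrite pq in H1.
rewrite (_ : p0 - q0 = (p0 - q) - (q0 - q)); last by ring.
by apply: le_trans (ler_normB _ _) _; lra.
Qed.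

End rowvectors.

(** * Functions of class C^k on an open set *)
Section Ck.
Context {R : realType} {n : nat}.
Variable A : set 'rV[R]_n.
Hypothesis oA : open A.
Implicit Types (f g : 'rV[R]_n -> R) (x y z : 'rV[R]_n) (i j : 'I_n) (k : nat).

Local Notation e_ i := (delta_mx ord0 i : 'rV[R]_n).

(** An inductive form of C^k regularity, suited to proofs by induction on [k]
    that follow the Leibniz rule. *)
Fixpoint Ck_on k f : Prop :=
  (forall x, A x -> {for x, continuous f}) /\
  if k is k'.+1
  then forall i, (forall x, A x -> derivable f x (e_ i)) /\ Ck_on k' (partial i f)
  else True.

Lemma Ck_cont k f x : Ck_on k f -> A x -> {for x, continuous f}.
Proof. by case: k => [|k] [h _]; exact: h. Qed.

Lemma Ck_derivable k f i x : Ck_on k.+1 f -> A x -> derivable f x (e_ i).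
Proof. by move=> [_ h]; exact: (h i).1. Qed.

#[global] Arguments Ck_derivable {k f} i {x}.

Lemma Ck_partial k f i : Ck_on k.+1 f -> Ck_on k (partial i f).
Proof. by move=> [_ h]; exact: (h i).2. Qed.

#[global] Arguments Ck_partial {k f} i.

Lemma Ck_pred k f : Ck_on k.+1 f -> Ck_on k f.
Proof.
elim: k f => [|k IH] f [h d]; split => // i.
by split; [exact: (d i).1|exact/IH/(d i).2].
Qed.

Lemma near_open x : A x -> \forall z \near x, A z.
Proof. by move=> Ax; exact: open_nbhs_nbhs. Qed.

Lemma eq_on_near f g x : (forall z, A z -> f z = g z) -> A x ->
  \forall z \near x, f z = g z.
Proof. by move=> fg Ax; apply: filterS (near_open Ax) => z /fg. Qed.

Lemma eq_on_partial f g i : (forall z, A z -> f z = g z) ->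
  forall z, A z -> partial i f z = partial i g z.
Proof. by move=> fg z Az; apply: near_eq_derive; exact: eq_on_near. Qed.

Lemma eq_on_continuous f g x : (forall z, A z -> f z = g z) -> A x ->
  {for x, continuous f} -> {for x, continuous g}.
Proof.
move=> fg Ax fc; rewrite /prop_for /continuous_at -(fg _ Ax).
apply: cvg_trans fc; apply: (@near_eq_cvg _ _ (nbhs x)).
exact: eq_on_near.
Qed.

(** Differentiation rules only hold on [A], so that the derivative of a sum or
    product agrees with the expected function on [A] only; this congruence
    transfers regularity between the two. *)
Lemma Ck_eq k f g : (forall z, A z -> f z = g z) -> Ck_on k f -> Ck_on k g.
Proof.
elim: k f g => [|k IH] f g fg [h d].
  by split=> // x Ax; exact: eq_on_continuous (h x Ax).
split=> [x Ax|i]; first exact: eq_on_continuous (h x Ax).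
split=> [x Ax|].
  exact: (near_eq_derivable (eq_on_near fg Ax) ((d i).1 x Ax)).
by apply: IH (d i).2; exact: eq_on_partial.
Qed.

Lemma smooth_on_Ck k f : smooth_on A f -> Ck_on k f.
Proof.
move=> fs; suff : forall s, Ck_on k (iter_partial s f) by move/(_ [::]).
elim: k => [|k IH] s; (split; first by move=> x /(fs s)[]) => // i.
by split=> [x Ax|]; [exact: (fs s x Ax).2|exact: (IH (i :: s))].
Qed.

Lemma partialD f g i x : derivable f x (e_ i) -> derivable g x (e_ i) ->
  partial i (f + g) x = partial i f x + partial i g x.
Proof. exact: deriveD. Qed.

Lemma partialN f i x : derivable f x (e_ i) ->
  partial i (- f) x = - partial i f x.
Proof. exact: deriveN. Qed.

Lemma partialM f g i x : derivable f x (e_ i) -> derivable g x (e_ i) ->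
  partial i (f * g) x = f x * partial i g x + g x * partial i f x.
Proof. exact: deriveM. Qed.

Lemma CkD k f g : Ck_on k f -> Ck_on k g -> Ck_on k (f + g).
Proof.
elim: k f g => [|k IH] f g Hf Hg.
  by split=> // x Ax; apply: continuousD; have := Ck_cont Hf Ax; have := Ck_cont Hg Ax.
split=> [x Ax|i].
  by apply: continuousD; have := Ck_cont Hf Ax; have := Ck_cont Hg Ax.
split=> [x Ax|].
  by apply: derivableD; [exact: (Ck_derivable i Hf Ax)|exact: (Ck_derivable i Hg Ax)].
apply: (@Ck_eq _ (partial i f + partial i g)) => [z Az|].
  by rewrite (partialD (Ck_derivable i Hf Az) (Ck_derivable i Hg Az)).
by apply: IH; exact: Ck_partial.
Qed.

Lemma CkN k f : Ck_on k f -> Ck_on k (- f).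
Proof.
elim: k f => [|k IH] f Hf.
  by split=> // x Ax; apply: continuousN; have := Ck_cont Hf Ax.
split=> [x Ax|i].
  by apply: continuousN; have := Ck_cont Hf Ax.
split=> [x Ax|]; first by apply: derivableN; exact: (Ck_derivable i Hf Ax).
apply: (@Ck_eq _ (- partial i f)) => [z Az|].
  by rewrite (partialN (Ck_derivable i Hf Az)).
by apply: IH; exact: Ck_partial.
Qed.

Lemma CkM k f g : Ck_on k f -> Ck_on k g -> Ck_on k (f * g).
Proof.
elim: k f g => [|k IH] f g Hf Hg.
  by split=> // x Ax; apply: continuousM; have := Ck_cont Hf Ax; have := Ck_cont Hg Ax.
split=> [x Ax|i].
  by apply: continuousM; have := Ck_cont Hf Ax; have := Ck_cont Hg Ax.
split=> [x Ax|].
  by apply: derivableM; [exact: (Ck_derivable i Hf Ax)|exact: (Ck_derivable i Hg Ax)].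
apply: (@Ck_eq _ (f * partial i g + g * partial i f)) => [z Az|].
  by rewrite (partialM (Ck_derivable i Hf Az) (Ck_derivable i Hg Az)).
by apply: CkD; apply: IH; (exact: Ck_partial || exact: Ck_pred).
Qed.

Lemma partial_cst (c : R) i : partial i (cst c) = cst 0.
Proof. by apply/funext => z; exact: derive_cst. Qed.

Lemma Ck_cst k (c : R) : Ck_on k (cst c).
Proof.
elim: k c => [|k IH] c; (split; first by move=> x _; exact: cst_continuous) => // i.
by rewrite partial_cst; split=> // x _; exact: derivable_cst.
Qed.

Lemma Ck_sum k (I : Type) (r : seq I) (h : I -> 'rV[R]_n -> R) :
  (forall a, Ck_on k (h a)) -> Ck_on k (\sum_(a <- r) h a).
Proof.
move=> H; elim/big_rec : _ => [|a f _ Hf]; first exact: (Ck_cst k 0).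
exact: CkD.
Qed.

Lemma is_derive_Ck f x v : Ck_on 1 f -> A x ->
  is_derive x v f (\sum_i v ord0 i * partial i f x).
Proof.
move=> Hf Ax; apply: is_derive_C1 => i.
  by apply: filterS (near_open Ax) => z Az; exact: (Ck_derivable i Hf Az).
exact: (Ck_cont (Ck_partial i Hf) Ax).
Qed.

Lemma Ck_partialC f x i j : Ck_on 2 f -> A x ->
  partial j (partial i f) x = partial i (partial j f) x.
Proof.
move=> Hf Ax; apply: (@partialC _ _ f A) => //.
- by move=> z Az; split; [exact: (Ck_derivable i Hf Az)|];
    exact: (Ck_derivable j (Ck_partial i Hf) Az).
- by move=> z Az; split; [exact: (Ck_derivable j Hf Az)|];
    exact: (Ck_derivable i (Ck_partial j Hf) Az).
- exact: (Ck_cont (Ck_partial j (Ck_partial i Hf)) Ax).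
- exact: (Ck_cont (Ck_partial i (Ck_partial j Hf)) Ax).
Qed.

Lemma laplacian_sumE f : laplacian f = \sum_i partial i (partial i f).
Proof. by apply/funext => z; rewrite fct_sumE. Qed.

Lemma grad_sq_sumE f : grad_sq f = \sum_i partial i f * partial i f.
Proof.
by apply/funext => z; rewrite fct_sumE; apply: eq_bigr => i _; rewrite expr2.
Qed.

Lemma Ck_laplacian k f : Ck_on k.+2 f -> Ck_on k (laplacian f).
Proof.
move=> Hf; rewrite laplacian_sumE.
by apply: Ck_sum => i; do 2 apply: Ck_partial.
Qed.

Lemma Ck_grad_sq k f : Ck_on k.+1 f -> Ck_on k (grad_sq f).
Proof.
move=> Hf; rewrite grad_sq_sumE.
by apply: Ck_sum => i; apply: CkM; exact: Ck_partial.
Qed.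

Lemma partial_sum (r : seq 'I_n) (h : 'I_n -> 'rV[R]_n -> R) i x :
  (forall j, Ck_on 1 (h j)) -> A x ->
  partial i (\sum_(j <- r) h j) x = \sum_(j <- r) partial i (h j) x.
Proof.
move=> H Ax; elim: r => [|j r IH].
  by rewrite !big_nil; have -> := @partial_cst 0 i.
rewrite !big_cons partialD ?IH//; first exact: (Ck_derivable i (H j) Ax).
by apply: (@Ck_derivable 0) => //; exact: Ck_sum.
Qed.

Lemma laplacianD f g x : Ck_on 2 f -> Ck_on 2 g -> A x ->
  laplacian (f + g) x = laplacian f x + laplacian g x.
Proof.
move=> Hf Hg Ax; rewrite /laplacian -big_split/=; apply: eq_bigr => i _.
rewrite (@eq_on_partial _ (partial i f + partial i g))//.
  by rewrite (partialD (Ck_derivable i (Ck_partial i Hf) Ax)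
    (Ck_derivable i (Ck_partial i Hg) Ax)).
by move=> z Az; by rewrite (partialD (Ck_derivable i Hf Az) (Ck_derivable i Hg Az)).
Qed.

Lemma laplacianN f x : Ck_on 2 f -> A x ->
  laplacian (- f) x = - laplacian f x.
Proof.
move=> Hf Ax; rewrite /laplacian -sumrN; apply: eq_bigr => i _.
rewrite (@eq_on_partial _ (- partial i f))//.
  by rewrite (partialN (Ck_derivable i (Ck_partial i Hf) Ax)).
by move=> z Az; by rewrite (partialN (Ck_derivable i Hf Az)).
Qed.

Lemma laplacian_sum (r : seq 'I_n) (h : 'I_n -> 'rV[R]_n -> R) x :
  (forall j, Ck_on 2 (h j)) -> A x ->
  laplacian (\sum_(j <- r) h j) x = \sum_(j <- r) laplacian (h j) x.
Proof.
move=> H Ax; elim: r => [|j r IH].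
  rewrite !big_nil /laplacian big1// => i _.
  by rewrite (@partial_cst 0 i) (@partial_cst 0 i).
by rewrite !big_cons laplacianD ?IH//; exact: Ck_sum.
Qed.

Lemma laplacianM f g x : Ck_on 2 f -> Ck_on 2 g -> A x ->
  laplacian (f * g) x = f x * laplacian g x + g x * laplacian f x
    + 2 * \sum_i partial i f x * partial i g x.
Proof.
move=> Hf Hg Ax; rewrite /laplacian !mulr_sumr -!big_split/=.
apply: eq_bigr => i _.
rewrite (@eq_on_partial _ (f * partial i g + g * partial i f))//; last first.
  by move=> z Az; by rewrite (partialM (Ck_derivable i Hf Az) (Ck_derivable i Hg Az)).
have df := Ck_derivable i Hf Ax; have dg := Ck_derivable i Hg Ax.
have ddf := Ck_derivable i (Ck_partial i Hf) Ax.
have ddg := Ck_derivable i (Ck_partial i Hg) Ax.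
have dfg := derivableM df ddg; have dgf := derivableM dg ddf.
rewrite (partialD dfg dgf) (partialM df ddg) (partialM dg ddf).
move: (partial i (partial i f) x) (partial i (partial i g) x) => a b.
move: (partial i f x) (partial i g x) => c d.
ring.
Qed.

(** The third-order terms of lap |grad f|^2 and of lap (f lap f) cancel only
    after this exchange of derivatives. *)
Lemma laplacian_partial f i x : Ck_on 3 f -> A x ->
  laplacian (partial i f) x = partial i (laplacian f) x.
Proof.
move=> Hf Ax; rewrite [laplacian f]laplacian_sumE.
have H1 j : Ck_on 1 (partial j (partial j f)) := Ck_partial j (Ck_partial j Hf).
rewrite (partial_sum _ i H1 Ax); apply: eq_bigr => j _.
rewrite (Ck_partialC j i (Ck_partial j Hf) Ax).
apply: (eq_on_partial j _ Ax) => z Az.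
exact: (Ck_partialC i j (Ck_pred Hf) Az).
Qed.

Lemma laplacian_grad_sq f x : Ck_on 3 f -> A x ->
  laplacian (grad_sq f) x =
  2 * hess_sq f x + 2 * \sum_i partial i f x * partial i (laplacian f) x.
Proof.
move=> Hf Ax; rewrite grad_sq_sumE.
have H2 i : Ck_on 2 (partial i f) by exact: Ck_partial.
have H22 i : Ck_on 2 (partial i f * partial i f) by exact: CkM.
rewrite (laplacian_sum _ H22 Ax).
rewrite /hess_sq -mulrDr -big_split/= mulr_sumr; apply: eq_bigr => i _.
rewrite (laplacianM (H2 i) (H2 i) Ax) (laplacian_partial i Hf Ax).
under [X in _ + 2 * X = _]eq_bigr do rewrite -expr2.
by move: (partial i f x) (partial i _ x) (\sum_(_ < n) _) => a b c; ring.
Qed.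

End Ck.

(** * The subharmonic quantity *)
Section P_functions.
Context {R : realType} {n : nat}.
Implicit Types (u : 'rV[R]_n -> R).

Definition P_function u x : R := grad_sq u x - u x * laplacian u x.

Variable A : set 'rV[R]_n.
Hypothesis oA : open A.

Lemma P_function_Ck u k : Ck_on A k.+2 u -> Ck_on A k (P_function u).
Proof.
move=> Hu.
have -> : P_function u = grad_sq u - u * laplacian u by [].
apply: CkD => //; first exact/Ck_pred/Ck_grad_sq.
by apply/CkN => //; apply: CkM => //; [exact/Ck_pred/Ck_pred|exact: Ck_laplacian].
Qed.

Lemma laplacian_P_function u x : Ck_on A 4 u -> A x ->
  laplacian (P_function u) x =
  2 * hess_sq u x - laplacian u x ^+ 2 - u x * bilaplacian u x.
Proof.
move=> Hu Ax.
have Hg : Ck_on A 2 (grad_sq u) by exact/Ck_grad_sq/Ck_pred.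
have Hu2 : Ck_on A 2 u by do 2 apply: Ck_pred.
have Hl : Ck_on A 2 (laplacian u) by exact: Ck_laplacian.
have -> : P_function u = grad_sq u - u * laplacian u by [].
have Hul : Ck_on A 2 (u * laplacian u) by exact: CkM.
have HN : Ck_on A 2 (- (u * laplacian u)) by exact: CkN.
rewrite (laplacianD oA Hg HN Ax) (laplacianN oA Hul Ax).
rewrite (laplacianM oA Hu2 Hl Ax) (laplacian_grad_sq oA (Ck_pred Hu) Ax).
rewrite /bilaplacian.
move: (hess_sq u x) (laplacian (laplacian u) x) (laplacian u x) (u x)
  (\sum_i _) => a b c d e; ring.
Qed.

End P_functions.

(** * Lebesgue measure on tuples and functions on row vectors *)
Section measurability.
Context {R : realType} {n : nat}.
Local Notation T := (measurableTypeR R).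
Implicit Types (f : 'rV[R]_n -> R) (t : n.-tuple T).

Definition rowt t : 'rV[R]_n := \row_i tnth t i.

(** Rounding each coordinate down to a grid takes countably many values, each
    on a product of half-open intervals, so every function of the rounded point
    is measurable. *)
Lemma measurable_grid (K : R) (P : set {ffun 'I_n -> int}) : 0 < K ->
  measurable [set t | P [ffun i => Num.floor (K * tnth t i)]].
Proof.
move=> K0.
pose F (v : {ffun 'I_n -> int}) : set (n.-tuple T) := if `[< P v >] then
  \bigcap_(i in [set: 'I_n]) ((fun t => tnth t i) @^-1`
     `[(v i)%:~R / K, (v i + 1)%:~R / K[) else set0.
have -> : [set t | P [ffun i => Num.floor (K * tnth t i)]] = \bigcup_v F v.
  apply/seteqP; split=> [t /= Pt|t [v _]].
    exists [ffun i => Num.floor (K * tnth t i)] => //.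
    rewrite /F; case: asboolP => // _ i _ /=.
    by rewrite in_itv/= ffunE ler_pdivrMr// ltr_pdivlMr// mulrC floor_itv.
  rewrite /F; case: asboolP => // Pv Fv /=.
  rewrite (_ : [ffun i => _] = v)//; apply/ffunP => i; rewrite ffunE.
  apply: floor_def; have := Fv i I; rewrite /= in_itv/=.
  by rewrite ler_pdivrMr// ltr_pdivlMr// mulrC.
apply: countable_bigcupT_measurable; first exact: countableP.
move=> v; rewrite /F; case: asboolP => // _.
apply: fin_bigcap_measurable => // i _.
rewrite -[X in measurable X]setTI.
by apply: measurable_tnth => //; exact: measurable_itv.
Qed.

(** Continuity links the topology of row vectors to the product sigma-algebra
    on tuples: [f] is the limit of its values at the points rounded to the grids
    of step [1 / (k + 1)], which are measurable by [measurable_grid]. *)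
Lemma measurable_fun_rowt f (A : set 'rV[R]_n) :
  (forall x, A x -> {for x, continuous f}) ->
  measurable_fun (rowt @^-1` A) (f \o rowt).
Proof.
move=> fc.
pose q (k : nat) (v : {ffun 'I_n -> int}) : 'rV[R]_n :=
  \row_i ((v i)%:~R / k.+1%:R).
pose grid (k : nat) t : {ffun 'I_n -> int} :=
  [ffun i => Num.floor (k.+1%:R * tnth t i)].
apply: (@measurable_realfun.measurable_fun_cvg _ _ _ _
  (fun k t => f (q k (grid k t)))) => [k|t At].
  apply: measurable_funTS => _ Y mY; rewrite setTI.
  exact: (@measurable_grid k.+1%:R [set v | Y (f (q k v))]).
have -> : (fun k => f (q k (grid k t))) = f \o (fun k => q k (grid k t)) by [].
apply: (@cvg_comp _ _ _ (fun k => q k (grid k t)) f _ (nbhs (rowt t))).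
  (* a coordinate and its rounding differ by less than the grid step *)
  apply/cvgrPdist_le => e e0; near=> k.
  rewrite norm_rV_le ?(ltW e0)//; apply/forallP => i; rewrite !mxE ffunE.
  have k0 : (0 : R) < k.+1%:R by [].
  have /andP[] := floor_itv (k.+1%:R * tnth t i).
  set v := Num.floor _; rewrite intrD => h1 h2.
  have -> : tnth t i - v%:~R / k.+1%:R
      = (k.+1%:R * tnth t i - v%:~R) / k.+1%:R :> R.
    by rewrite mulrBl [X in _ = X - _]mulrAC mulfV ?mul1r// gt_eqF.
  rewrite ger0_norm ?divr_ge0 ?subr_ge0//.
  apply: (@le_trans _ _ (k.+1%:R^-1)).
    by rewrite ler_pdivrMr// mulVf ?gt_eqF// lerBlDl ltW.
  by apply: ltW; near: k; exact: (near_infty_natSinv_lt (PosNum e0)).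
exact: fc.
Unshelve. all: by end_near.
Qed.

Lemma measurable_continuous f : continuous f ->
  measurable_fun setT (f \o rowt).
Proof.
by move=> fc; have := @measurable_fun_rowt f setT (fun x _ => fc x); rewrite preimage_setT.
Qed.

End measurability.

Section boxes.
Context {R : realType}.
Local Notation T := (measurableTypeR R).

Definition box n (c : 'rV[R]_n) (r : R) : set 'rV[R]_n :=
  [set z | forall i, `|z ord0 i - c ord0 i| <= r].

Lemma measurable_box n (c : 'rV[R]_n) r :
  measurable ((@rowt R n) @^-1` box c r).
Proof.
have -> : (@rowt R n) @^-1` box c r = \bigcap_(i in [set: 'I_n])
    ((fun t : n.-tuple T => tnth t i) @^-1` `[c ord0 i - r, c ord0 i + r]).
  apply/seteqP; split=> t /= h i.
    move=> _; have := h i; rewrite /= !mxE in_itv/= ler_distl => /andP[h1 h2].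
    by apply/andP.
  by have := h i I; rewrite /= !mxE in_itv/= ler_distl.
apply: fin_bigcap_measurable => // i _.
rewrite -[X in measurable X]setTI.
by apply: measurable_tnth => //; exact: measurable_itv.
Qed.

Definition consv n (x : R) (z : 'rV[R]_n) : 'rV[R]_n.+1 :=
  \row_j oapp (z ord0) x (unlift ord0 j).

Lemma consv0 n x (z : 'rV[R]_n) : consv x z ord0 ord0 = x.
Proof. by rewrite mxE unlift_none. Qed.

Lemma consvS n x (z : 'rV[R]_n) j : consv x z ord0 (lift ord0 j) = z ord0 j.
Proof. by rewrite mxE liftK. Qed.

Lemma consv_ext n (y z : 'rV[R]_n.+1) :
  y ord0 ord0 = z ord0 ord0 ->
  (forall j, y ord0 (lift ord0 j) = z ord0 (lift ord0 j)) -> y = z.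
Proof.
move=> h0 hS; apply/rowP => j.
by have [k ->|->] := unliftP ord0 j; [exact: hS|exact: h0].
Qed.

Lemma rowt_cons n (p : T * n.-tuple T) :
  rowt (tcons p) = consv p.1 (rowt p.2) :> 'rV[R]_n.+1.
Proof.
apply: consv_ext => [|j]; rewrite ?consv0 ?consvS !mxE.
  by rewrite (tnth_nth 0).
by rewrite !(tnth_nth 0).
Qed.

Lemma lebesgue_tuple_box n (c : 'rV[R]_n) r : 0 <= r ->
  lebesgue_tuple n ((@rowt R n) @^-1` box c r) = ((2 * r) ^+ n)%:E.
Proof.
move=> r0; elim: n c => [|n IH] c.
  rewrite /= diracE mem_set//=; by case.
pose c' : 'rV[R]_n := \row_j c ord0 (lift ord0 j).
have E : @tcons R n @^-1` ((@rowt R n.+1) @^-1` box c r) =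
    `[c ord0 ord0 - r, c ord0 ord0 + r] `*` ((@rowt R n) @^-1` box c' r).
  apply/seteqP; split=> [p /= h|p /= [h1 h2] j]; last first.
    rewrite rowt_cons; have [k ->|->] := unliftP ord0 j.
      by rewrite consvS; have := h2 k; rewrite [c' _ _]mxE.
    by move: h1; rewrite consv0 in_itv/= ler_distl.
  split=> [|j].
    by have := h ord0; rewrite rowt_cons consv0 ler_distl in_itv.
  by have := h (lift ord0 j); rewrite rowt_cons consvS [c' _ _]mxE.
rewrite /= /lebesgue_cons /pushforward E product_measure1E//; last first.
  exact: measurable_box.
have L : lebesgue_measure (`[c ord0 ord0 - r, c ord0 ord0 + r]%classic : set R)
    = (2 * r)%:E.
  rewrite lebesgue_measure_itv/= lte_fin.
  have -> : ((c ord0 ord0 + r)%:E - (c ord0 ord0 - r)%:E)%E = (2 * r)%:E.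
    by rewrite -EFinB; congr _%:E; ring.
  by case: ltP => // rr; congr _%:E; lra.
by rewrite IH [X in (X * _)%E]L exprS EFinM.
Qed.

Lemma compact_box n (c : 'rV[R]_n) r : compact (box c r).
Proof.
have -> : box c r = [set v : 'rV[R]_n | forall i,
    `[c ord0 i - r, c ord0 i + r]%classic (v ord0 i)].
  apply/seteqP; split=> z /= h i; have := h i; rewrite ?in_itv/=;
    by rewrite ler_distl.
apply: (@rV_compact R n (fun i => `[c ord0 i - r, c ord0 i + r]%classic)) => i.
exact: segment_compact.
Qed.

Lemma compact_bound n (f : 'rV[R]_n -> R) (K : set 'rV[R]_n) : compact K ->
  (forall x, K x -> {for x, continuous f}) ->
  exists2 M : R, 0 <= M & forall x, K x -> `|f x| <= M.
Proof.
move=> cK fc.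
have : compact (f @` K).
  by apply: continuous_compact => //; apply: continuous_in_subspaceT => x;
    rewrite inE; exact: fc.
move=> /compact_bounded[M [_ HM]].
exists (Num.max 0 (M + 1)) => [|x Kx]; first by rewrite le_max lexx.
apply: (HM (Num.max 0 (M + 1))); last by exists x.
by rewrite lt_max ltrDl ltr01 orbT.
Qed.

(** Together with continuity this is the class of integrands used below: it is
    stable under fixing a coordinate, as Fubini's theorem requires. *)
Definition box_supported n (f : 'rV[R]_n -> R) :=
  exists (c : 'rV[R]_n) (r : R), 0 <= r /\ forall z, ~ box c r z -> f z = 0.

Lemma integrable_box_supported n (f : 'rV[R]_n -> R) :
  continuous f -> box_supported f ->
  (lebesgue_tuple n).-integrable setT (EFin \o (f \o (@rowt R n))).
Proof.
move=> fc [c [r [r0 fs]]].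
have [M M0 fM] := compact_bound (@compact_box n c r) (fun x _ => fc x).
have mB := measurable_box c r.
have -> : EFin \o (f \o (@rowt R n)) =
    (EFin \o (f \o (@rowt R n))) \_ (@rowt R n @^-1` box c r).
  apply/funext => t; rewrite patchE; case: ifPn => //.
  by rewrite notin_setE => /= /fs /= ->.
apply/(integrable_restrict _ mB) => //; rewrite setTI.
apply: measurable_bounded_integrable => //.
- by rewrite [X in (X < _)%E](lebesgue_tuple_box c r0) ltry.
- by apply: measurable_funTS; exact: measurable_continuous.
- exists M; split; first exact: num_real.
  by move=> N MN t /= Bt; apply: le_trans (ltW MN); exact: fM.
Qed.

End boxes.

Section slices.
Context {R : realType}.
Local Notation T := (measurableTypeR R).
Local Notation mu := (@lebesgue_measure R).

Definition upd n (i : 'I_n) (s : R) (z : 'rV[R]_n) : 'rV[R]_n :=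
  \row_j if j == i then s else z ord0 j.

Lemma upd_line n (i : 'I_n) s (z : 'rV[R]_n) :
  upd i s z = upd i 0 z + s *: delta_mx ord0 i.
Proof.
apply/rowP => j; rewrite !mxE eqxx/=.
by case: (j == i); rewrite ?mulr1 ?mulr0 ?addr0 ?add0r.
Qed.

Lemma upd_consv0 n s x (z : 'rV[R]_n) : upd ord0 s (consv x z) = consv s z.
Proof.
by apply: consv_ext => [|j]; rewrite mxE ?consv0 ?consvS.
Qed.

Lemma upd_consvS n (j : 'I_n) s x (z : 'rV[R]_n) :
  upd (lift ord0 j) s (consv x z) = consv x (upd j s z).
Proof.
apply: consv_ext => [|k]; rewrite mxE ?consv0 ?consvS//.
by rewrite (inj_eq lift_inj) mxE.
Qed.

Lemma consv_continuous n x : continuous (@consv R n x).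
Proof.
move=> z A nA.
have /nbhs_ballP[e /= e0 eA] : nbhs (consv x z : 'rV[R]_n.+1) A := nA.
apply/nbhs_ballP; exists e => //= y.
rewrite -ball_normE /= => zy; apply: eA; rewrite -ball_normE /=.
apply: le_lt_trans zy.
rewrite norm_rV_le//; apply/forallP => j.
have [k ->|->] := unliftP ord0 j; rewrite !mxE ?unlift_none/= ?subrr ?normr0//.
by have := ler_coord_norm (z - y) k; rewrite !mxE liftK.
Qed.

Lemma box_supported_consv n x (f : 'rV[R]_n.+1 -> R) :
  box_supported f -> box_supported (fun z => f (consv x z)).
Proof.
move=> [c [r [r0 fs]]].
exists (\row_j c ord0 (lift ord0 j)), r; split => // z zB; apply: fs => h.
by apply: zB => j; have := h (lift ord0 j); rewrite consvS mxE.
Qed.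

Section cons.
Variables (n : nat) (f : 'rV[R]_n.+1 -> R).
Hypotheses (fc : continuous f) (fs : box_supported f).

Let g : T * n.-tuple T -> \bar R := fun p => (f (consv p.1 (rowt p.2)))%:E.

Let gE : g = (EFin \o (f \o (@rowt R n.+1))) \o @tcons R n.
Proof. by apply/funext => p; rewrite /g /= rowt_cons. Qed.

Let mf : measurable_fun setT (EFin \o (f \o (@rowt R n.+1))).
Proof. by apply/measurable_EFinP; exact: measurable_continuous. Qed.

Lemma integrable_consv : (mu \x lebesgue_tuple n)%E.-integrable setT g.
Proof.
apply/integrableP; split.
  by rewrite gE; apply: measurableT_comp => //; exact: measurable_tcons.
have /integrableP[_] := integrable_box_supported fc fs.
apply: le_lt_trans.
rewrite [leRHS]ge0_integral_pushforward//; last 2 first.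
- exact: measurable_tcons.
- exact: measurableT_comp.
by rewrite gE.
Qed.

Lemma integral_consv :
  (\int[lebesgue_tuple n.+1]_t (f (rowt t))%:E =
   \int[mu \x lebesgue_tuple n]_p g p)%E.
Proof.
rewrite /= (@integral_pushforward _ _ _ _ _ (@tcons R n)
   (@measurable_tcons R n) _ setT (EFin \o (f \o (@rowt R n.+1))))//=.
- by rewrite preimage_setT gE.
- by rewrite preimage_setT -gE; exact: integrable_consv.
Qed.

End cons.

(** By induction on the dimension: the first coordinate is integrated first
    when [i] is the first index, and last otherwise, the inner integral then
    vanishing by the induction hypothesis. *)
Lemma integral_null_slices n (f : 'rV[R]_n -> R) (i : 'I_n) :
  continuous f -> box_supported f ->
  (forall z, (\int[mu]_s (f (upd i s z))%:E = 0)%E) ->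
  (\int[lebesgue_tuple n]_t (f (rowt t))%:E = 0)%E.
Proof.
elim: n f i => [|n IH] f i fc fs f0; first by case: i f0.
rewrite integral_consv//.
have gi := integrable_consv fc fs.
have [j ij|i0] := unliftP ord0 i.
  rewrite -integral12_prod_meas1//.
  apply: integral0_eq => x _; rewrite /fubini_F/=.
  apply: (IH (fun z => f (consv x z)) j).
  - move=> z; apply: continuous_comp; [exact: consv_continuous|exact: fc].
  - exact: box_supported_consv.
  - move=> z; rewrite -[RHS](f0 (consv x z)).
    by apply: eq_integral => s _; rewrite ij upd_consvS.
rewrite -integral21_prod_meas1//.
apply: integral0_eq => t _; rewrite /fubini_G/= -[RHS](f0 (consv 0 (rowt t))).
by apply: eq_integral => s _; rewrite i0 upd_consv0.
Qed.

End slices.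

(** * The weight eta and its potential psi *)
Section positive_part.
Context {R : realType}.

Definition pos_sq (s : R) : R := Num.max 0 s ^+ 2.

(** Squaring the positive part smooths its kink at 0, which is why [psi] is C^1
    across the unit sphere. *)
Lemma is_derive_pos_sq (s : R) : is_derive s 1 pos_sq (2 * Num.max 0 s).
Proof.
have [s0|s0|->] := ltgtP s 0.
- rewrite mulr0.
  apply: (@near_eq_is_derive _ _ _ (cst 0)).
  near=> t; rewrite /pos_sq max_l ?expr0n//.
  by apply: ltW; near: t; exact: lt_nbhsl.
- apply: (@near_eq_is_derive _ _ _ (fun t : R => t ^+ 2)).
    near=> t; rewrite /pos_sq max_r//.
    by apply: ltW; near: t; exact: lt_nbhsr.
  have -> : (fun t : R => t ^+ 2) = id * id :> (R -> R).
    by apply/funext => t; rewrite expr2.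
  by apply: is_derive_eq; rewrite /GRing.scale/=; ring.
- rewrite mulr0.
  have C : (fun h : R => h^-1 *: ((pos_sq \o shift 0) (h *: (1:R)) - pos_sq 0)) @ 0^'
      --> (0 : R).
    apply/cvgrPdist_le => e e0; near=> h.
    have h0 : h != 0 by near: h; exact: nbhs_dnbhs_neq.
    rewrite sub0r normrN /= [_%:A]mulr1 addr0 /pos_sq maxxx expr0n/= subr0.
    rewrite normrM normfV ler_pdivrMl ?normr_gt0// normrX expr2.
    have hh : `|Num.max 0 h| <= `|h|.
      by case: (leP 0 h) => // _; rewrite normr0.
    apply: ler_pM => //; apply: le_trans hh _; near: h; exact: dnbhs0_le.
  by split; [apply/cvg_ex; exists 0|exact: cvg_lim C].
Unshelve. all: by end_near. Qed.

Lemma pos_part_continuous : continuous (fun s : R => Num.max 0 s).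
Proof.
by move=> s; apply: (@continuous_max _ _ (fun=> 0) id);
  [exact: cst_continuous|exact: cvg_id].
Qed.

End positive_part.

Section bump.
Context {R : realType} {n : nat}.
Implicit Types (x y z : 'rV[R]_n) (i j : 'I_n).
Local Notation e_ i := (delta_mx ord0 i : 'rV[R]_n).

Definition sqn y : R := \sum_i y ord0 i ^+ 2.

Lemma sqn_ge0 y : 0 <= sqn y.
Proof. by apply: sumr_ge0 => i _; exact: sqr_ge0. Qed.

Lemma coord_sq_le_sqn y i : y ord0 i ^+ 2 <= sqn y.
Proof.
by rewrite /sqn (bigD1 i)//= lerDl; apply: sumr_ge0 => j _; exact: sqr_ge0.
Qed.

Lemma coord_le_sqn y i (b : R) : 0 <= b -> sqn y <= b ^+ 2 -> `|y ord0 i| <= b.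
Proof.
move=> b0 yb; rewrite -(ler_pXn2r (n := 2))// ?nnegrE// real_normK ?num_real//.
exact: le_trans (coord_sq_le_sqn y i) yb.
Qed.

Lemma sqn_line y i (t : R) :
  sqn (y + t *: e_ i) = sqn y + (2 * y ord0 i * t + t ^+ 2).
Proof.
rewrite /sqn (bigD1 i)//= [in RHS](bigD1 i)//= !mxE !eqxx/= mulr1.
rewrite (eq_bigr (fun j => y ord0 j ^+ 2)); last first.
  by move=> j ji; rewrite !mxE eqxx/= (negbTE ji) mulr0 addr0.
ring.
Qed.

Lemma sqnZ (r : R) y : sqn (r *: y) = r ^+ 2 * sqn y.
Proof.
by rewrite /sqn mulr_sumr; apply: eq_bigr => i _; rewrite mxE exprMn.
Qed.

Lemma sqn_continuous : continuous (sqn : 'rV[R]_n -> R).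
Proof.
have -> : (sqn : 'rV[R]_n -> R) = \sum_i (fun y : 'rV[R]_n => y ord0 i ^+ 2).
  by apply/funext => y; rewrite fct_sumE.
move=> y; elim/big_rec : _ => [|i g _ gc]; first exact: cst_continuous.
apply: continuousD => //.
apply: (@continuous_comp _ _ _ (fun y : 'rV[R]_n => y ord0 i) (fun t : R => t ^+ 2)).
  exact: coord_continuous.
exact: exprn_continuous.
Qed.

(** The weights are chosen so that [psi] is C^1 and its gradient is
    [- (z - x) eta]: the radial field [(z - x) eta] met when differentiating a
    dilation is then a gradient. *)
Definition eta x z : R := Num.max 0 (1 - sqn (z - x)).
Definition psi x z : R := eta x z ^+ 2 / 4.

Lemma eta_ge0 x z : 0 <= eta x z.
Proof. by rewrite /eta le_max lexx. Qed.

Lemma eta_le1 x z : eta x z <= 1.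
Proof. by rewrite /eta ge_max ler01/= gerBl sqn_ge0. Qed.

Lemma psi_ge0 x z : 0 <= psi x z.
Proof. by rewrite /psi divr_ge0// sqr_ge0. Qed.

Lemma eta_out x z : 1 <= sqn (z - x) -> eta x z = 0.
Proof. by move=> h; rewrite /eta max_l// subr_le0. Qed.

Lemma psi_out x z : 1 <= sqn (z - x) -> psi x z = 0.
Proof. by move=> h; rewrite /psi eta_out// expr0n mul0r. Qed.

Lemma sqnB_continuous x : continuous (fun z => sqn (z - x)).
Proof.
move=> z; apply: (@continuous_comp _ _ _ (fun z => z - x) sqn).
  by apply: continuousB; [exact: cvg_id|exact: cst_continuous].
exact: sqn_continuous.
Qed.

Lemma eta_continuous x : continuous (eta x).
Proof.
move=> z; apply: (@continuous_comp _ _ _ (fun z => 1 - sqn (z - x))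
  (fun s => Num.max 0 s)); last exact: pos_part_continuous.
by apply: continuousB; [exact: cst_continuous|exact: sqnB_continuous].
Qed.

Lemma psi_continuous x : continuous (psi x).
Proof.
have -> : psi x = (eta x * eta x) * cst 4^-1.
  by apply/funext => z; rewrite /psi expr2.
move=> z; apply: continuousM; last exact: cst_continuous.
by apply: continuousM; exact: eta_continuous.
Qed.

Lemma is_derive_psi x z i :
  is_derive z (e_ i) (psi x) (- (z ord0 i - x ord0 i) * eta x z).
Proof.
apply: is_derive_of_line.
pose b : R := z ord0 i - x ord0 i.
pose q (t : R) : R := 1 - sqn (z - x) - (2 * b * t + t ^+ 2).
have -> : (fun t : R => psi x (z + t *: e_ i)) = 4^-1 \*: (pos_sq \o q).
  apply/funext => t; rewrite /psi /eta /= addrAC sqn_line !mxE.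
  by rewrite mulrC /pos_sq /q /b opprD addrA.
have dq : is_derive (0 : R) 1 q (- (2 * b)).
  have -> : q = cst (1 - sqn (z - x)) - ((2 * b) \*: id + id * id) :> (R -> R).
    by apply/funext => t; rewrite /q !fctE/= expr2.
  by apply: is_derive_eq; rewrite /GRing.scale/=; ring.
have q0 : q 0 = 1 - sqn (z - x) by rewrite /q; ring.
have := @is_derive1_comp _ pos_sq q 0 _ _ (is_derive_pos_sq (q 0)) dq.
move=> /(is_deriveZ 4^-1) H; apply: (is_derive_eq H).
rewrite /eta q0 /GRing.scale/= /b; by field.
Qed.

Lemma open_outside x : open [set z : 'rV[R]_n | 1 < sqn (z - x)].
Proof.
apply: (@open_comp _ _ (fun z => sqn (z - x)) [set s : R | 1 < s]).
  by move=> z _; exact: sqnB_continuous.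
exact: open_gt.
Qed.

(** The factor [h] is arbitrary outside the closed unit ball around [x], where
    the cutoff [k] erases it. *)
Lemma cutoff_continuous x (h k : 'rV[R]_n -> R) :
  continuous k -> (forall z, 1 <= sqn (z - x) -> k z = 0) ->
  (forall z, sqn (z - x) <= 1 -> {for z, continuous h}) ->
  continuous (h * k).
Proof.
move=> kc k0 hc z.
have [z1|z1] := leP (sqn (z - x)) 1.
  by apply: continuousM; [exact: hc|exact: kc].
apply: (@eq_on_continuous _ _ _ (@open_outside x) (cst 0)) => // [y y1|].
  by rewrite !fctE k0 ?mulr0// ltW.
exact: cst_continuous.
Qed.

Lemma out_box x z : ~ box x 1 z -> 1 <= sqn (z - x).
Proof.
move=> nb; rewrite leNgt; apply/negP => s1; apply: nb => i.
have := @coord_le_sqn (z - x) i 1 ler01; rewrite expr1n !mxE.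
by apply; exact: ltW.
Qed.

Lemma cutoff_supported x (h k : 'rV[R]_n -> R) :
  (forall z, 1 <= sqn (z - x) -> k z = 0) -> box_supported (h * k).
Proof.
move=> k0; exists x, 1; split=> // z /out_box z1.
by rewrite !fctE k0// mulr0.
Qed.

End bump.

(** * Integration by parts for dilated functions *)
Section dilation.
Context {R : realType} {n : nat}.
Variables (A : set 'rV[R]_n) (x : 'rV[R]_n) (b : R).

Hypothesis ballA : forall y, sqn (y - x) <= b ^+ 2 -> A y.
Implicit Types (y z : 'rV[R]_n) (i j : 'I_n) (r : R) (g : 'rV[R]_n -> R).
Local Notation e_ i := (delta_mx ord0 i : 'rV[R]_n).
Local Notation mu := (@lebesgue_measure R).

Definition dil r z : 'rV[R]_n := x + r *: (z - x).

Lemma sqn_dil r z : - b < r < b -> sqn (z - x) <= 1 ->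
  sqn (dil r z - x) <= b ^+ 2.
Proof.
move=> /andP[br rb] z1; rewrite /dil addrC addKr sqnZ.
have r2 : r ^+ 2 <= b ^+ 2 by nra.
by apply: le_trans r2; rewrite -[leRHS]mulr1; apply: ler_wpM2l => //; exact: sqr_ge0.
Qed.

Lemma dil_in r z : - b < r < b -> sqn (z - x) <= 1 -> A (dil r z).
Proof. by move=> rb z1; apply: ballA; exact: sqn_dil. Qed.

Lemma dil_continuous r : continuous (dil r).
Proof.
move=> z; apply: (@continuousD _ _ _ (cst x) (fun z => r *: (z - x))).
  exact: cst_continuous.
apply: (@continuous_comp _ _ _ (fun z => z - x) (fun y => r *: y)).
  by apply: continuousB; [exact: cvg_id|exact: cst_continuous].
exact: scaler_continuous.
Qed.

Lemma comp_dil_continuous g r : - b < r < b ->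
  (forall y, A y -> {for y, continuous g}) ->
  forall z, sqn (z - x) <= 1 -> {for z, continuous (g \o dil r)}.
Proof.
move=> rb gc z z1; apply: continuous_comp; first exact: dil_continuous.
exact: gc (dil_in rb z1).
Qed.

Lemma is_derive_comp_dil g r z i : - b < r < b -> sqn (z - x) <= 1 ->
  (forall y, A y -> derivable g y (e_ i)) ->
  is_derive z (e_ i) (g \o dil r) (r * partial i g (dil r z)).
Proof.
move=> rb z1 gd; apply: is_derive_of_line.
have -> : (fun t : R => (g \o dil r) (z + t *: e_ i))
    = (fun t : R => g (dil r z + t *: (r *: e_ i))).
  apply/funext => t /=; congr g.
  by rewrite /dil [z + _ - x]addrAC scalerDr addrA !scalerA [r * t]mulrC.
apply: is_derive_line; rewrite scale0r addr0; apply: is_derive_scale.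
exact: derivableP (gd _ (dil_in rb z1)).
Qed.

Section flux.
Variables (g : 'rV[R]_n -> R) (i : 'I_n) (r : R).
Hypotheses (rb : - b < r < b)
  (gc : forall y, A y -> {for y, continuous g})
  (gd : forall y, A y -> derivable g y (e_ i))
  (gdc : forall y, A y -> {for y, continuous (partial i g)}).

(** With [g = partial i f] this is the [i]-th component of the vector field
    psi (z) grad f (x + r (z - x)), and [dflux] the [i]-th term of its
    divergence. *)
Definition flux : 'rV[R]_n -> R := (g \o dil r) * psi x.

Definition dflux : 'rV[R]_n -> R :=
  (cst r * (partial i g \o dil r)) * psi x
  - ((fun z => z ord0 i - x ord0 i) * (g \o dil r)) * eta x.

Lemma is_derive_flux z : is_derive z (e_ i) flux (dflux z).
Proof.
have [z1|z1] := leP (sqn (z - x)) 1.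
  have d1 := is_derive_comp_dil rb z1 gd.
  have d2 := is_derive_psi x z i.
  apply: is_derive_eq.
  rewrite /dflux !fctE /= /GRing.scale/=.
  move: (g _) (partial i g _) (psi x z) (eta x z) (_ - _) => a c d e k; ring.
have -> : dflux z = 0.
  by rewrite /dflux !fctE psi_out ?ltW// eta_out ?ltW// !mulr0 subr0.
apply: (@near_eq_is_derive _ _ _ (cst 0)).
apply: filterS (near_open (@open_outside _ _ x) z1) => y /ltW y1.
by rewrite /flux !fctE psi_out// mulr0.
Qed.

Lemma dflux_continuous : continuous dflux.
Proof.
have gr := comp_dil_continuous rb gc.
have gdr := comp_dil_continuous rb gdc.
move=> z; apply: continuousB.
  apply: (@cutoff_continuous _ _ x); [exact: psi_continuous|exact: psi_out|].
  by move=> y y1; apply: continuousM; [exact: cst_continuous|exact: gdr].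
apply: (@cutoff_continuous _ _ x); [exact: eta_continuous|exact: eta_out|].
move=> y y1; apply: continuousM; last exact: gr.
apply: continuousB; [exact: coord_continuous|exact: cst_continuous].
Qed.

Lemma dflux_out z : 1 <= sqn (z - x) -> dflux z = 0.
Proof. by move=> z1; rewrite /dflux !fctE psi_out// eta_out// !mulr0 subr0. Qed.

Lemma dflux_supported : box_supported dflux.
Proof. by exists x, 1; split=> // z /out_box; exact: dflux_out. Qed.

Lemma upd_out (s : R) z : 1 <= `|s - x ord0 i| -> 1 <= sqn (upd i s z - x).
Proof.
move=> s1; apply: le_trans (coord_sq_le_sqn _ i).
rewrite !mxE eqxx -[leRHS]real_normK ?num_real//.
by rewrite -[leLHS](expr1n _ 2) ler_pXn2r// nnegrE.
Qed.

(** On a line in the direction [e_i] the integrand is the derivative of [flux],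
    which vanishes at distance at least 1 from [x]. *)
Lemma integral_dflux_slice z : (\int[mu]_s (dflux (upd i s z))%:E = 0)%E.
Proof.
pose F s := flux (upd i s z); pose F' s := dflux (upd i s z).
(* the line meets the unit ball around x inside [u, v] only *)
pose u := x ord0 i - 1; pose v := x ord0 i + 1.
have uv : u < v by rewrite /u /v; lra.
have dF (s : R) : is_derive s 1 F (F' s).
  rewrite /F (_ : (fun s => _) = (fun s => flux (upd i 0 z + s *: e_ i))); last first.
    by apply/funext => t; rewrite upd_line.
  by apply: is_derive_line; rewrite -upd_line; exact: is_derive_flux.
have F'c : continuous F'.
  move=> s; rewrite /F'.
  rewrite (_ : (fun s => _) = dflux \o (fun s : R => upd i 0 z + s *: e_ i));
    last first.
    by apply/funext => t /=; rewrite upd_line.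
  apply: continuous_comp; last exact: dflux_continuous.
  apply: continuousD; first exact: cst_continuous.
  exact: scalel_continuous.
have Fc : continuous F.
  by move=> s; apply/differentiable_continuous/derivable1_diffP.
have -> : (fun s => (dflux (upd i s z))%:E) = (fun s => (F' s)%:E) \_ `[u, v].
  apply/funext => s; rewrite patchE; case: ifPn => //.
  rewrite notin_setE /= in_itv/= => /negP; rewrite negb_and -!ltNge => suv.
  rewrite dflux_out//; apply: upd_out.
  by case/orP : suv; rewrite /u /v => h; [rewrite ler0_norm|rewrite ger0_norm]; lra.
rewrite -integral_mkcond.
rewrite (@continuous_FTC2 _ F' F u v)//.
- have F0 s : 1 <= `|s - x ord0 i| -> F s = 0.
    by move=> s1; rewrite /F /flux !fctE psi_out ?mulr0//; exact: upd_out.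
  rewrite !F0 ?subee//; first by rewrite /u ler0_norm; lra.
  by rewrite /v ger0_norm; lra.
- exact: continuous_subspaceT.
- split; first by move=> s _; exact: ex_derive.
  + exact/cvg_at_right_filter/Fc.
  + exact/cvg_at_left_filter/Fc.
- by move=> s _; rewrite derive1E; exact: derive_val.
Qed.

Lemma integral_dflux :
  (\int[lebesgue_tuple n]_t (dflux (rowt t))%:E = 0)%E.
Proof.
apply: (@integral_null_slices _ _ _ i).
- exact: dflux_continuous.
- exact: dflux_supported.
- exact: integral_dflux_slice.
Qed.

End flux.

End dilation.

(** * The mean value inequality for subharmonic functions *)
Section mean.
Context {R : realType} {n : nat}.
Variables (A : set 'rV[R]_n) (x : 'rV[R]_n) (b : R) (f : 'rV[R]_n -> R).
Hypotheses (oA : open A) (b1 : 1 < b).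
Hypothesis ballA : forall y, sqn (y - x) <= b ^+ 2 -> A y.
Hypothesis f2 : Ck_on A 2 f.
Hypothesis lap_ge0 : forall y, A y -> 0 <= laplacian f y.
Implicit Types (y z : 'rV[R]_n) (i j : 'I_n) (r : R).
Local Notation e_ i := (delta_mx ord0 i : 'rV[R]_n).
Local Notation lam := (lebesgue_tuple n).

Let f1 : Ck_on A 1 f := Ck_pred f2.
Let fp i : Ck_on A 1 (partial i f) := Ck_partial i f2.

(** The integrand of phi, whose value at [r = 0] is [f x * eta x z] and at
    [r = 1] is [f z * eta x z]. *)
Definition smeared r : 'rV[R]_n -> R := (f \o dil x r) * eta x.

Definition dsmeared r : 'rV[R]_n -> R := fun z =>
  (\sum_i (z ord0 i - x ord0 i) * partial i f (dil x r z)) * eta x z.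

Lemma is_derive_smeared r z : - b < r < b ->
  is_derive r 1 (fun s => smeared s z) (dsmeared r z).
Proof.
move=> rb; rewrite /smeared /dsmeared.
have [z1|z1] := leP 1 (sqn (z - x)).
  rewrite eta_out// mulr0.
  rewrite (_ : (fun s => _) = cst 0); first exact: is_derive_cst.
  by apply/funext => s; rewrite !fctE eta_out// mulr0.
have Az := dil_in ballA rb (ltW z1).
have := is_derive_line (is_derive_Ck oA (z - x) f1 Az).
move=> /(is_deriveZ (eta x z)).
rewrite (_ : eta x z \*: _ = (fun s => ((f \o dil x s) * eta x) z)); last first.
  by apply/funext => s; rewrite !fctE /= mulrC.
rewrite [_ *: _]mulrC; under eq_bigr do rewrite !mxE.
by [].
Qed.

(** The integration by parts, pointwise: the terms [dflux] integrate to 0. *)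
Lemma dsmearedE r z :
  dsmeared r z = r * laplacian f (dil x r z) * psi x z
    - \sum_i dflux x (partial i f) i r z.
Proof.
rewrite /dsmeared /laplacian mulr_sumr !mulr_suml -sumrB; apply: eq_bigr => i _.
rewrite /dflux !fctE /=.
move: (psi x z) (eta x z) (partial i f _) (partial i (partial i f) _) => d e a c; ring.
Qed.

Lemma smeared_continuous r : - b < r < b -> continuous (smeared r).
Proof.
move=> rb; apply: (@cutoff_continuous _ _ x); [exact: eta_continuous|exact: eta_out|].
by apply: (comp_dil_continuous ballA rb) => y; exact: Ck_cont f2.
Qed.

Lemma smeared_supported r : box_supported (smeared r).
Proof. apply: cutoff_supported; exact: eta_out. Qed.

Lemma dflux_partial_continuous r i : - b < r < b ->
  continuous (dflux x (partial i f) i r).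
Proof.
move=> rb; apply: (dflux_continuous ballA rb) => y Ay.
- exact: (Ck_cont (fp i) Ay).
- exact: (Ck_cont (Ck_partial i (fp i)) Ay).
Qed.

Lemma integral_dflux_partial r i : - b < r < b ->
  (\int[lam]_t (dflux x (partial i f) i r (rowt t))%:E = 0)%E.
Proof.
move=> rb; apply: (integral_dflux ballA rb) => y Ay.
- exact: (Ck_cont (fp i) Ay).
- exact: (Ck_derivable i (fp i) Ay).
- exact: (Ck_cont (Ck_partial i (fp i)) Ay).
Qed.

Definition source r : 'rV[R]_n -> R := (cst r * (laplacian f \o dil x r)) * psi x.

Lemma source_continuous r : - b < r < b -> continuous (source r).
Proof.
move=> rb; apply: (@cutoff_continuous _ _ x); [exact: psi_continuous|exact: psi_out|].
move=> z z1; apply: continuousM; first exact: cst_continuous.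
apply: (comp_dil_continuous ballA rb) => // y Ay.
exact: (Ck_cont (Ck_laplacian oA f2) Ay).
Qed.

Lemma source_ge0 r z : 0 <= r < b -> 0 <= source r z.
Proof.
move=> /andP[r0 rb]; rewrite /source !fctE /=.
have [z1|z1] := leP 1 (sqn (z - x)); first by rewrite psi_out// mulr0.
apply: mulr_ge0; last exact: psi_ge0.
apply: mulr_ge0 => //; apply: lap_ge0; apply: (dil_in ballA); last exact: ltW.
by rewrite rb andbT; lra.
Qed.

(** Only the term in the laplacian survives integration, and it is
    nonnegative. *)
Lemma integral_dsmeared_ge0 r : 0 <= r < b ->
  0 <= Rintegral lam setT (dsmeared r \o (@rowt R n)).
Proof.
move=> /andP[r0 rb].
have rbb : - b < r < b by rewrite rb andbT; lra.
have ints : lam.-integrable setT (EFin \o (source r \o (@rowt R n))).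
  apply: integrable_box_supported; first exact: source_continuous.
  by apply: cutoff_supported; exact: psi_out.
have intd i : lam.-integrable setT (EFin \o (dflux x (partial i f) i r \o (@rowt R n))).
  apply: integrable_box_supported; first exact: dflux_partial_continuous.
  exact: dflux_supported.
have -> : dsmeared r \o (@rowt R n) = (fun t => source r (rowt t)
    - \sum_i dflux x (partial i f) i r (rowt t)).
  by apply/funext => t /=; rewrite dsmearedE.
suff sum0 (s : seq 'I_n) :
    lam.-integrable setT
      (EFin \o (fun t => \sum_(i <- s) dflux x (partial i f) i r (rowt t)))
    /\ Rintegral lam setT
      (fun t => \sum_(i <- s) dflux x (partial i f) i r (rowt t)) = 0.
  have [is0 s0] := sum0 (index_enum 'I_n).
  rewrite RintegralB// s0 subr0; apply: Rintegral_ge0 => t _.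
  by apply: source_ge0; rewrite r0.
elim: s => [|i s [IH1 IH2]].
  split.
    rewrite (_ : _ \o _ = cst 0%E); first exact: integrable0.
    by apply/funext => t /=; rewrite big_nil.
  by under eq_Rintegral do rewrite big_nil; rewrite Rintegral_cst// mul0r.
have E : (fun t => \sum_(j <- i :: s) dflux x (partial j f) j r (rowt t)) =
   (fun t => dflux x (partial i f) i r (rowt t)
     + \sum_(j <- s) dflux x (partial j f) j r (rowt t)).
  by apply/funext => t; rewrite big_cons.
rewrite E; split; last first.
  rewrite (RintegralD measurableT (intd i) IH1) IH2 addr0 /Rintegral.
  by rewrite (integral_dflux_partial _ rbb).
exact: (integrableD _ (intd i) IH1).
Qed.

(** A bound uniform in [r], as needed to differentiate under the integral sign:
    the dilated points stay in the compact ball of radius [b] around [x], on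
    which the partial derivatives of [f] are bounded. *)
Lemma dsmeared_bound : exists2 M : R, 0 <= M &
  forall r z, - b < r < b -> `|dsmeared r z| <= M * eta x z.
Proof.
pose K := [set y : 'rV[R]_n | sqn (y - x) <= b ^+ 2].
have cK : compact K.
  apply: (@subclosed_compact _ K (box x b)); last 2 first.
  - exact: compact_box.
  - move=> y /= yb i.
    have b0 : 0 <= b by apply: ltW; apply: lt_trans b1.
    by have := coord_le_sqn i b0 yb; rewrite !mxE.
  apply: (@closed_comp _ _ (fun y => sqn (y - x)) [set s : R | s <= b ^+ 2]).
    by move=> y _; exact: sqnB_continuous.
  exact: closed_le.
have bnd i : {M : R | 0 <= M & forall y, K y -> `|partial i f y| <= M}.
  apply: cid2; apply: compact_bound => // y Ky.
  exact: (Ck_cont (fp i) (ballA Ky)).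
exists (\sum_i s2val (bnd i)).
  by apply: sumr_ge0 => i _; exact: (s2valP (bnd i)).
move=> r z rb; rewrite /dsmeared normrM (ger0_norm (eta_ge0 x z)).
have [z1|z1] := leP 1 (sqn (z - x)); first by rewrite eta_out// !mulr0.
apply: ler_wpM2r; first exact: eta_ge0.
apply: le_trans (ler_norm_sum _ _ _) _; apply: ler_sum => i _.
rewrite normrM -[leRHS]mul1r; apply: ler_pM => //.
  have := @coord_le_sqn _ _ (z - x) i 1 ler01; rewrite expr1n !mxE.
  by apply; exact: ltW.
by apply: (s2valP' (bnd i)); exact: sqn_dil rb (ltW z1).
Qed.

Let phi r := Rintegral lam setT (fun t => smeared r (rowt t)).

Lemma is_derive_phi r : - b < r < b ->
  is_derive r 1 phi (Rintegral lam setT (dsmeared r \o (@rowt R n))).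
Proof.
move=> rb; have [M M0 HM] := dsmeared_bound.
have int_s s : `]- b, b[%classic s ->
    lam.-integrable setT (EFin \o (fun t => smeared s (rowt t))).
  rewrite /= in_itv/= => sb.
  exact: (integrable_box_supported (smeared_continuous sb) (@smeared_supported s)).
have der_s s (t : n.-tuple (measurableTypeR R)) : `]- b, b[%classic s -> setT t ->
    derivable (fun s => smeared s (rowt t)) s 1.
  rewrite /= in_itv/= => sb _.
  exact: (@ex_derive _ _ _ _ _ _ _ (is_derive_smeared (rowt t) sb)).
pose G (t : n.-tuple (measurableTypeR R)) := M * eta x (rowt t).
have G0 t : 0 <= G t by rewrite mulr_ge0// eta_ge0.
have intG : lam.-integrable setT (EFin \o G).
  apply: (@integrable_box_supported _ _ (cst M * eta x)).
    move=> z; apply: continuousM; [exact: cst_continuous|exact: eta_continuous].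
  by apply: cutoff_supported; exact: eta_out.
have d1 s t : - b < s < b ->
    partial1of2 (fun s t => smeared s (rowt t)) s t = dsmeared s (rowt t).
  move=> sb; rewrite partial1of2E.
  exact: (@derive_val _ _ _ _ _ _ _ (is_derive_smeared (rowt t) sb)).
have Gub s t : `]- b, b[%classic s -> setT t ->
    `|partial1of2 (fun s t => smeared s (rowt t)) s t| <= G t.
  by rewrite /= in_itv/= => sb _; rewrite d1//; exact: HM.
have rI : `]- b, b[%classic r by rewrite /= in_itv.
split.
  exact: (derivable_under_integral measurableT rI int_s der_s G0 intG Gub).
rewrite -derive1E.
rewrite (differentiation_under_integral measurableT rI int_s der_s G0 intG Gub).
by apply: eq_Rintegral => t _; rewrite d1.
Qed.

(** phi is nondecreasing on [[0, 1]]; its values at the end points are the two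
    sides of the inequality. *)
Lemma mean_value_subharmonic :
  f x * Rintegral lam setT (eta x \o (@rowt R n))
  <= Rintegral lam setT (fun t => f (rowt t) * eta x (rowt t)).
Proof.
have inb r : 0 <= r <= 1 -> - b < r < b.
  by move=> /andP[r0 r1]; apply/andP; split; have := b1; lra.
have phi0 : phi 0 = f x * Rintegral lam setT (eta x \o (@rowt R n)).
  rewrite /phi -RintegralZl//.
    by apply: eq_Rintegral => t _; rewrite /smeared !fctE /= /dil scale0r addr0.
  apply: integrable_box_supported; first exact: eta_continuous.
  by exists x, 1; split=> // z /out_box; exact: eta_out.
have phi1 : phi 1 = Rintegral lam setT (fun t => f (rowt t) * eta x (rowt t)).
  apply: eq_Rintegral => t _.
  by rewrite /smeared !fctE /= /dil scale1r addrC subrK.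
rewrite -phi0 -phi1.
apply: (@ger0_derive1_ndecr _ phi 0 1) => //.
- move=> r; rewrite in_itv/= => /andP[/ltW r0 /ltW r1].
  have rb : - b < r < b by apply: inb; rewrite r0.
  exact: (@ex_derive _ _ _ _ _ _ _ (is_derive_phi rb)).
- move=> r; rewrite in_itv/= => /andP[/ltW r0 /ltW r1].
  have rb : - b < r < b by apply: inb; rewrite r0.
  rewrite derive1E (@derive_val _ _ _ _ _ _ _ (is_derive_phi rb)).
  by apply: integral_dsmeared_ge0; rewrite r0/=; case/andP: rb.
- apply: derivable_within_continuous => r; rewrite in_itv/= => /inb rb.
  exact: (@ex_derive _ _ _ _ _ _ _ (is_derive_phi rb)).
Qed.

End mean.

(** * Balls and norms *)
Section euclidean.
Context {R : realType} {n : nat}.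
Implicit Types (x y : 'rV[R]_n).

Lemma eball_sqn (r : R) x : 0 < r -> eball r x <-> sqn x < r ^+ 2.
Proof.
move=> r0; rewrite /eball/= /enorm -/(sqn x).
by rewrite -{1}(ger0_norm (ltW r0)) -sqrtr_sqr ltr_sqrt// exprn_gt0.
Qed.

Lemma open_eball (r : R) : 0 < r -> open (eball r : set 'rV[R]_n).
Proof.
move=> r0; rewrite (_ : eball r = sqn @^-1` [set s : R | s < r ^+ 2]).
  by apply: open_comp; [move=> y _; exact: sqn_continuous|exact: open_lt].
by apply/seteqP; split=> y /eball_sqn; apply.
Qed.

Lemma measurable_eball (r : R) : 0 < r ->
  measurable ((@rowt R n) @^-1` eball r).
Proof.
move=> r0.
rewrite (_ : _ @^-1` _ = (sqn \o (@rowt R n)) @^-1` `]-oo, r ^+ 2[).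
  rewrite -[X in measurable X]setTI.
  by apply: (measurable_continuous (@sqn_continuous R n)) => //; exact: measurable_itv.
by apply/seteqP; split=> t; rewrite /= in_itv/= => /eball_sqn; apply.
Qed.

(** A weighted form of the triangle inequality, proved coordinatewise; optimal
    when [a] and [b] are proportional to the lengths of [x] and [y]. *)
Lemma sqnD_le x y (a b : R) : 0 < a -> 0 < b ->
  sqn (x + y) <= (a + b) * (sqn x / a + sqn y / b).
Proof.
move=> a0 b0; rewrite /sqn !mulr_suml -big_split mulr_sumr/=.
apply: ler_sum => i _; rewrite mxE.
move: (x ord0 i) (y ord0 i) => p q.
rewrite -subr_ge0.
have -> : (a + b) * (p ^+ 2 / a + q ^+ 2 / b) - (p + q) ^+ 2
   = (b * p - a * q) ^+ 2 / (a * b).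
  by field; rewrite !gt_eqF.
by rewrite divr_ge0 ?sqr_ge0// mulr_ge0// ltW.
Qed.

(** With [a = (1 + |x|) / 2], strictly between [|x|] and 1, the radius
    [b = 2 - a] exceeds 1 while [|x| + b < 2]. *)
Lemma eball1_room x : eball 1 x ->
  exists2 b : R, 1 < b & forall y, sqn (y - x) <= b ^+ 2 -> eball 2 y.
Proof.
move=> x1; pose e := enorm x; pose a := (1 + e) / 2; pose b := 2 - a.
have e0 : 0 <= e by exact: sqrtr_ge0.
have e1 : e < 1 by [].
have a0 : 0 < a by rewrite /a; lra.
have b1 : 1 < b by rewrite /b /a; lra.
exists b => // y yb; apply/eball_sqn => //.
have b0 : 0 < b by lra.
have ex : sqn x = e ^+ 2 by rewrite /e /enorm sqr_sqrtr// sqn_ge0.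
have := sqnD_le x (y - x) a0 b0; rewrite addrC subrK => /le_lt_trans; apply.
have ab : a + b = 2 by rewrite /b; ring.
rewrite ab.
have h1 : sqn x / a < a.
  by rewrite ltr_pdivrMr// ex -expr2 ltr_pXn2r// ?nnegrE ?(ltW a0)// /a; lra.
have h2 : sqn (y - x) / b <= b by rewrite ler_pdivrMr// -expr2.
nra.
Qed.

Local Notation lam := (@lebesgue_tuple R n).

Lemma integrable_eta x : lam.-integrable setT (EFin \o (eta x \o (@rowt R n))).
Proof.
apply: integrable_box_supported; first exact: eta_continuous.
by exists x, 1; split=> // z /out_box; exact: eta_out.
Qed.

(** On the cube of half-side [1 / (2 n)] around [x] the squared distance to [x]
    is at most [1 / 2], so that [eta] is at least [1 / 2] there. *)
Lemma integral_eta_ge x : (0 < n)%N ->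
  n%:R^-1 ^+ n / 2 <= Rintegral lam setT (eta x \o (@rowt R n)).
Proof.
move=> n0.
have n1 : 1 <= n%:R :> R by rewrite ler1n.
have n0' : 0 < n%:R :> R by rewrite ltr0n.
pose r : R := (2 * n%:R)^-1.
have r0 : 0 <= r by rewrite invr_ge0 mulr_ge0.
have mB := measurable_box x r.
have half z : box x r z -> 2^-1 <= eta x z.
  move=> zB; rewrite /eta le_max; apply/orP; right.
  suff : sqn (z - x) <= 2^-1 by lra.
  apply: (@le_trans _ _ (\sum_(i < n) r ^+ 2)).
    apply: ler_sum => i _; rewrite !mxE -(real_normK (num_real _)).
    by rewrite ler_pXn2r ?nnegrE.
  rewrite sumr_const card_ord -[leLHS]mulr_natr expr2 -mulrA.
  have rn : r * n%:R = 2^-1 by rewrite /r invfM -mulrA mulVf ?mulr1// gt_eqF.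
  by rewrite rn; nra.
rewrite -lee_fin /Rintegral fineK; last exact: (integrable_fin_num _ (integrable_eta x)).
have meta : measurable_fun setT (fun t => (eta x (rowt t))%:E).
  by apply/measurable_EFinP; exact: (measurable_continuous (@eta_continuous R n x)).
apply: (@le_trans _ _ (\int[lam]_(t in (@rowt R n) @^-1` box x r)
  (eta x (rowt t))%:E)%E); last first.
  by apply: ge0_subset_integral => // t _; rewrite lee_fin eta_ge0.
apply: (@le_trans _ _ (\int[lam]_(t in (@rowt R n) @^-1` box x r) (cst (2^-1)%:E t))%E).
  rewrite integral_cst// [X in (_ * X)%E](lebesgue_tuple_box x r0) -EFinM lee_fin.
  by rewrite mulrC /r invfM mulrA mulfV// mul1r.
apply: ge0_le_integral => //.
- by move=> t _; rewrite lee_fin.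
- exact: measurable_funTS.
- by move=> t /half; rewrite lee_fin.
Qed.

End euclidean.

Section norms.
Context {R : realType} {n : nat}.
Local Notation lam := (@lebesgue_tuple R n).
Implicit Types (f : 'rV[R]_n -> R).

Lemma poweR2 (a : \bar R) : (0 <= a -> a `^ 2 = a ^+ 2)%E.
Proof.
case: a => [a|_|//].
  by rewrite lee_fin => a0; rewrite poweR_EFin powR_mulrn// EFin_expe.
by rewrite poweRyr// ?expe2 ?mulyy.
Qed.

Lemma L2norm_sq (A : set 'rV[R]_n) f :
  (L2norm A f ^+ 2 = \int[lam]_t ((f \_ A) (rowt t) ^+ 2)%:E)%E.
Proof.
rewrite -poweR2; last exact: Lnorm_ge0.
rewrite poweR_Lnorm//; apply: eq_integral => t _.
by rewrite poweR2 ?abse_ge0// abse_EFin -EFin_expe real_normK ?num_real.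
Qed.

Lemma H1norm_sq (A : set 'rV[R]_n) f :
  (H1norm A f ^+ 2 = L2norm A f ^+ 2 + \sum_(i < n) L2norm A (partial i f) ^+ 2)%E.
Proof.
rewrite /H1norm sqr_sqrte// adde_ge0 ?sqre_ge0//.
by apply: sume_ge0 => i _; exact: sqre_ge0.
Qed.

Lemma add_sqre_le (a b : \bar R) : (0 <= a -> 0 <= b ->
  a ^+ 2 + b ^+ 2 <= (a + b) ^+ 2)%E.
Proof.
move=> a0 b0; rewrite !expe2 ge0_muleDl// leeD//.
  by rewrite lee_pmul// leeDl.
by rewrite lee_pmul// leeDr.
Qed.

Lemma measurable_patch_sq f (r : R) : 0 < r ->
  (forall y, eball r y -> {for y, continuous f}) ->
  measurable_fun setT (fun t : n.-tuple (measurableTypeR R) =>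
    ((f \_ (eball r)) (rowt t) ^+ 2)%:E).
Proof.
move=> r0 fc; apply/measurable_EFinP.
apply: (@measurable_funX _ _ _ _ (fun t => (f \_ (eball r)) (rowt t))).
have -> : (fun t => (f \_ (eball r)) (rowt t))
    = (f \o (@rowt R n)) \_ (@rowt R n @^-1` eball r).
  apply/funext => t; rewrite !patchE.
  rewrite (_ : (t \in _) = (rowt t \in eball r))//.
apply/(measurable_restrictT _ (measurable_eball r0)).
exact: measurable_fun_rowt.
Qed.

End norms.

(** * The estimate *)
Section upper_bound.
Context {R : realType} {n : nat}.
Local Notation lam := (@lebesgue_tuple R n).
Implicit Types (u : 'rV[R]_n -> R).

(** Pointwise, |P| eta is at most |grad u|^2 + u^2 + (lap u)^2 on the ball of
    radius 2, and it vanishes outside. *)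
Lemma integral_P_function_eta_le u x (b : R) : smooth_on (eball 2) u ->
  1 < b -> (forall y, sqn (y - x) <= b ^+ 2 -> eball 2 y) ->
  ((Rintegral lam setT (fun t => P_function u (rowt t) * eta x (rowt t)))%:E
   <= (H1norm (eball 2) u + L2norm (eball 2) (laplacian u)) ^+ 2)%E.
Proof.
move=> us b1 room.
have o2 : open (eball 2 : set 'rV[R]_n) by exact: open_eball.
have uk k : Ck_on (eball 2) k u by exact: smooth_on_Ck.
have Pc := P_function_Ck o2 (uk 2).
have inB z : sqn (z - x) <= 1 -> eball 2 z.
  move=> z1; apply: room; apply: le_trans z1 _.
  by rewrite exprn_ege1// ltW.
pose g : 'rV[R]_n -> R := P_function u * eta x.
have gc : continuous g.
  apply: (@cutoff_continuous _ _ x); [exact: eta_continuous|exact: eta_out|].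
  by move=> z /inB Bz; exact: (Ck_cont Pc Bz).
have gint : lam.-integrable setT (EFin \o (g \o (@rowt R n))).
  apply: integrable_box_supported => //.
  by apply: cutoff_supported; exact: eta_out.
have mg : measurable_fun setT (fun t => (g (rowt t))%:E).
  by apply/measurable_EFinP; exact: measurable_continuous.
pose sq (f : 'rV[R]_n -> R) : n.-tuple (measurableTypeR R) -> \bar R :=
  fun t => ((f \_ (eball 2)) (rowt t) ^+ 2)%:E.
have sq0 f t : (0 <= sq f t)%E by rewrite lee_fin sqr_ge0.
have msq (f : 'rV[R]_n -> R) k : Ck_on (eball 2) k f -> measurable_fun setT (sq f).
  by move=> fk; apply: measurable_patch_sq => // y By; exact: (Ck_cont fk By).
have mu0 := msq _ _ (uk 0).
have mui i := msq _ _ (Ck_partial i (uk 1)).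
have mul := msq _ _ (Ck_laplacian o2 (uk 2)).
rewrite /Rintegral fineK; last exact: (integrable_fin_num _ gint).
apply: (le_trans (lee_abs _)).
apply: (le_trans (le_abse_integral _ measurableT mg)).
have H0 : (0 <= H1norm (eball 2) u)%E by exact: sqrte_ge0.
have L0 : (0 <= L2norm (eball 2) (laplacian u))%E by exact: Lnorm_ge0.
apply: le_trans (add_sqre_le H0 L0).
rewrite H1norm_sq !L2norm_sq; under eq_bigr do rewrite L2norm_sq.
rewrite -(ge0_integral_sum _ measurableT mui (fun i t _ => sq0 _ t)).
have msum : measurable_fun setT (fun t => \sum_(i < n) sq (partial i u) t)%E.
  exact: emeasurable_sum.
have sum0 t : (0 <= \sum_(i < n) sq (partial i u) t)%E by apply: sume_ge0.
have E1 := ge0_integralD lam measurableT (fun t _ => sq0 u t) mu0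
  (fun t _ => sum0 t) msum.
have usum0 t : (0 <= sq u t + \sum_(i < n) sq (partial i u) t)%E.
  by rewrite adde_ge0.
have musum := emeasurable_funD mu0 msum.
have E2 := ge0_integralD lam measurableT (fun t _ => usum0 t) musum
  (fun t _ => sq0 (laplacian u) t) mul.
rewrite -[X in (X + _)%E]E1 -[leRHS]E2.
apply: ge0_le_integral => //.
- exact: measurableT_comp.
- by apply: emeasurable_funD => //; exact: emeasurable_funD.
move=> t _ /=.
have [tB|tB] := pselect (eball 2 (rowt t)); last first.
  have -> : g (rowt t) = 0.
    by rewrite /g !fctE eta_out ?mulr0// leNgt; apply/negP => /ltW /inB.
  by rewrite normr0 !adde_ge0.
rewrite /sq; under eq_bigr do rewrite patchE mem_set//.
rewrite !patchE !mem_set// sumEFin -!EFinD lee_fin /g !fctE normrM.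
rewrite (ger0_norm (eta_ge0 _ _)).
apply: (@le_trans _ _ `|P_function u (rowt t)|).
  by rewrite ler_piMr// eta_le1.
rewrite /P_function /grad_sq.
have s0 : 0 <= \sum_i partial i u (rowt t) ^+ 2 by apply: sumr_ge0 => i _; exact: sqr_ge0.
move: s0 (u (rowt t)) (laplacian u (rowt t)); set s := \sum_i _ => s0 p q.
by rewrite ler_norml; apply/andP; split; nra.
Qed.

End upper_bound.

(* The norm on the right-hand side is squared: the left-hand side is quadratic
   in u and the hypotheses are invariant under u -> l u, so the inequality with
   the first power fails for u(x) = l x_1, F = w^2 / 2 and l large. *)
Theorem corollary6p6 (R : realType) (n : nat) (n_gt0 : (0 < n)%N) :
  exists2 C : R, 0 < C &
    forall (F : R -> R -> R -> R) (u : 'rV[R]_n -> R),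
      (forall s t w : R, 2^-1 * w ^+ 2 <= F s t w) ->
      smooth_on (eball 2) u ->
      (forall x, eball 2 x ->
         hess_sq u x = F (u x) (grad_sq u x) (laplacian u x)
                       + u x / 2 * bilaplacian u x) ->
      forall x, eball 1 x ->
        ((grad_sq u x - u x * laplacian u x)%:E
         <= C%:E * (H1norm (eball 2) u
                    + L2norm (eball 2) (laplacian u)) ^+ 2)%E.
Proof.
pose c : R := n%:R^-1 ^+ n / 2.
have c0 : 0 < c by rewrite divr_gt0// exprn_gt0// invr_gt0 ltr0n.
(* c is the lower bound of the integral of eta *)
exists c^-1; first by rewrite invr_gt0.
move=> F u HF us eqn x x1; rewrite -/(P_function u x).
have o2 : open (eball 2 : set 'rV[R]_n) by exact: open_eball.
have uk k : Ck_on (eball 2) k u by exact: smooth_on_Ck.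
have lapP y : eball 2 y -> 0 <= laplacian (P_function u) y.
  move=> By; rewrite (laplacian_P_function o2 (uk 4) By) (eqn _ By).
  have := HF (u y) (grad_sq u y) (laplacian u y); move: (F _ _ _) => w.
  move: (laplacian u y) (u y) (bilaplacian u y) => p q r; nra.
have [b b1 room] := eball1_room x1.
have := mean_value_subharmonic o2 b1 room (P_function_Ck o2 (uk 4)) lapP.
have := integral_P_function_eta_le us b1 room.
have := integral_eta_ge x n_gt0; rewrite -/c.
move: (Rintegral _ _ _) (Rintegral _ _ _) (P_function u x) => J I P cI JS PIJ.
set S := ((_ + _) ^+ 2)%E in JS *.
have S0 : (0 <= S)%E by exact: sqre_ge0.
have [P0|P0] := leP P 0.
  apply: (@le_trans _ _ 0%E); first by rewrite lee_fin.
  by rewrite mule_ge0// lee_fin invr_ge0 ltW.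
rewrite lee_pdivlMl// -EFinM mulrC.
apply: le_trans JS; rewrite lee_fin.
by apply: le_trans PIJ; apply: ler_wpM2l => //; exact: ltW.
Qed.
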